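(* Let $g:\mathbb{C}\to\mathbb{C}$ be measurable and set $d\nu:=|g|^2\,d\mu$. The following are equivalent: (i) $U_g$ extends to a bounded operator $L^2(\mu)\to F^2(\mathbb{C})$. (ii) Multiplication by $g$ is bounded from $F^2(\mathbb{C})$ into $L^2(\mu)$, i.e. there is $C>0$ with \[ \int_{\mathbb{C}}|g(z)|^2|h(z)|^2\,d\mu(z)\le C\|h\|_{F^2}^2\qquad\text{for all }h\in F^2(\mathbb{C}). \] (iii) $\nu$ is a Carleson measure for $F^2(\mathbb{C})$. (iv) With $k_a(w)=e^{w\overline a-|a|^2/2}$, \[ \sup_{a\in\mathbb{C}}\int_{\mathbb{C}}|k_a(z)|^2\,d\nu(z)=\sup_{a\in\mathbb{C}}\frac1\pi\int_{\mathbb{C}}e^{-|z-a|^2}|g(z)|^2\,dA(z)<\infty . \] (v) The Toeplitz form \[ \mathfrak{t}_{|g|^2}(f,h):=\int_{\mathbb{C}}|g(z)|^2f(z)\overline{h(z)}\,d\mu(z),\qquad f,h\in F^2(\mathbb{C}), \] is bounded on $F^2(\mathbb{C})\times F^2(\mathbb{C})$ (equivalently, it induces a bounded Toeplitz operator $T_{|g|^2}:F^2(\mathbb{C})\to F^2(\mathbb{C})$).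
   Context: $dA$ is planar Lebesgue measure, $d\mu(z)=\pi^{-1}e^{-|z|^2}\,dA(z)$, and $F^2(\mathbb{C})$ is the Bargmann space of entire $f$ with $\|f\|_{F^2}^2=\int_{\mathbb{C}}|f|^2\,d\mu<\infty$. $P:L^2(\mu)\to F^2(\mathbb{C})$ is the orthogonal projection. The operator $U_g$ has domain $\mathcal{D}(M_g)=\{f\in L^2(\mu):gf\in L^2(\mu)\}$ and acts by $U_gf=P(gf)$. A positive Borel measure $\nu$ on $\mathbb{C}$ is a Carleson measure for $F^2(\mathbb{C})$ (Fock--Carleson measure) if there is $C>0$ with $\int_{\mathbb{C}}|h|^2\,d\nu\le C\|h\|_{F^2}^2$ for all $h\in F^2(\mathbb{C})$. In (v), bounded means that the integral converges absolutely for all $f,h\in F^2(\mathbb{C})$ and $|\mathfrak{t}_{|g|^2}(f,h)|\le C\|f\|_{F^2}\|h\|_{F^2}$ for some constant $C$; the induced operator is determined by $\langle T_{|g|^2}f,h\rangle=\mathfrak{t}_{|g|^2}(f,h)$. *)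

(* Defs.v *)
From HB Require Import structures.
From mathcomp Require Import all_boot all_order all_algebra.
From mathcomp Require Import complex.
From mathcomp Require Import all_classical all_reals all_analysis.
From mathcomp Require Import measurable_realfun.
Set Implicit Arguments.
Unset Strict Implicit.
Unset Printing Implicit Defensive.
Import Order.TTheory GRing.Theory Num.Theory.
Import numFieldNormedType.Exports.
Local Open Scope classical_set_scope.
Local Open Scope ring_scope.
Local Open Scope complex_scope.

HB.instance Definition _ (R : realType) := NormedModule.copy R[i] R[i]^o.

Notation normc := ComplexField.Normc.normc.

Section complex_borel.
Variable R : realType.

Definition plane_of_complex (z : R[i]) : R * R := (complex.Re z, complex.Im z).
Definition complex_of_plane (p : R * R) : R[i] := p.1 +i* p.2.

(* The Borel sigma-algebra of the complex plane: the sigma-algebra of R * R is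
   the product of the Borel ones, hence the Borel sigma-algebra of R^2, and
   [plane_of_complex] is a homeomorphism. *)
Definition complex_measurable : set (set R[i]) :=
  preimage_set_system setT plane_of_complex measurable.

Let cm_sigma : sigma_algebra setT complex_measurable.
Proof.
apply: sigma_algebra_preimage; split; first exact: measurable0.
  by move=> A mA; rewrite setTD; exact: measurableC.
by move=> F mF; exact: bigcup_measurable.
Qed.

Let cm0 : complex_measurable set0. Proof. by case: cm_sigma. Qed.

Let cmC A : complex_measurable A -> complex_measurable (~` A).
Proof. by case: cm_sigma => _ + _ => /[apply]; rewrite setTD. Qed.

Let cmU (F : (set R[i])^nat) : (forall k, complex_measurable (F k)) ->
  complex_measurable (\bigcup_k F k).
Proof. by case: cm_sigma => _ _; exact. Qed.

HB.instance Definition _ :=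
  @isMeasurable.Build default_measure_display R[i] complex_measurable
    cm0 cmC cmU.

Lemma measurable_plane_of_complex : measurable_fun setT plane_of_complex.
Proof. by move=> _ B mB; exists B. Qed.

Lemma measurable_complex_of_plane : measurable_fun setT complex_of_plane.
Proof.
move=> _ _ [B mB <-]; rewrite !setTI.
suff -> : complex_of_plane @^-1` (plane_of_complex @^-1` B) = B by [].
by apply/seteqP; split=> -[].
Qed.

Lemma measurable_sqr_normc d (T : measurableType d) (g : T -> R[i]) :
  measurable_fun setT g -> measurable_fun setT (fun x => normc (g x) ^+ 2).
Proof.
move=> mg.
have mpg := measurableT_comp measurable_plane_of_complex mg.
have -> : (fun x => normc (g x) ^+ 2) =
    (fun x => (plane_of_complex (g x)).1 ^+ 2 + (plane_of_complex (g x)).2 ^+ 2).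
  apply/funext => x; case: (g x) => a b /=.
  by rewrite sqr_sqrtr// addr_ge0// sqr_ge0.
by apply: measurable_funD; apply: measurable_funX;
  apply: measurableT_comp mpg.
Qed.

End complex_borel.

Section density.
Context d (T : measurableType d) (R : realType).
Variables (m : {measure set T -> \bar R}) (w : T -> R).
Hypotheses (mw : measurable_fun setT w) (w0 : forall x, 0 <= w x).

(* The measure w dm. The arguments [mw] and [w0] are only there for the
   measure instance below. *)
Definition density_measure (_ : measurable_fun setT w)
    (_ : forall x, 0 <= w x) (A : set T) : \bar R :=
  (\int[m]_(x in A) (w x)%:E)%E.

Local Notation dm := (density_measure mw w0).

Let dm0 : dm set0 = 0%E. Proof. exact: integral_set0. Qed.

Let dm_ge0 A : (0 <= dm A)%E.
Proof. by apply: integral_ge0 => x _; rewrite lee_fin. Qed.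

Let dm_sigma_additive : semi_sigma_additive dm.
Proof.
apply: semi_sigma_additive_nng_induced; first exact/measurable_EFinP.
by move=> x; rewrite lee_fin.
Qed.

HB.instance Definition _ :=
  isMeasure.Build _ _ _ dm dm0 dm_ge0 dm_sigma_additive.

End density.

Section planar_measures.
Variable R : realType.

Definition planar_lebesgue : set R[i] -> \bar R :=
  pushforward (@lebesgue_measure R \x @lebesgue_measure R)%E
              (@complex_of_plane R).

Let pl0 : planar_lebesgue set0 = 0%E.
Proof. by rewrite /planar_lebesgue /pushforward preimage_set0 measure0. Qed.

Let pl_ge0 A : (0 <= planar_lebesgue A)%E.
Proof. by rewrite /planar_lebesgue /pushforward; exact: measure_ge0. Qed.

Let pl_sigma_additive : semi_sigma_additive planar_lebesgue.
Proof.
have mpre A : measurable A -> measurable (@complex_of_plane R @^-1` A).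
  by move=> mA; rewrite -[X in measurable X]setTI;
    exact: measurable_complex_of_plane.
move=> F mF tF mUF; rewrite /planar_lebesgue /pushforward preimage_bigcup.
apply: measure_semi_sigma_additive.
- by move=> n; exact: mpre.
- apply/trivIsetP => /= i j _ _ ij; rewrite -preimage_setI.
  by move/trivIsetP : tF => /(_ _ _ _ _ ij) ->//; rewrite preimage_set0.
- by rewrite -preimage_bigcup; exact: mpre.
Qed.

HB.instance Definition _ := isMeasure.Build _ _ _ planar_lebesgue
  pl0 pl_ge0 pl_sigma_additive.

Definition gauss_weight (z : R[i]) : R := pi^-1 * expR (- normc z ^+ 2).

Lemma measurable_gauss_weight : measurable_fun setT gauss_weight.
Proof.
apply: measurable_funM; first exact: measurable_cst.
apply: measurableT_comp => //; apply: measurable_funN.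
exact: measurable_sqr_normc.
Qed.

Lemma gauss_weight_ge0 z : 0 <= gauss_weight z.
Proof. by rewrite mulr_ge0 ?expR_ge0// invr_ge0 pi_ge0. Qed.

Definition gauss : {measure set R[i] -> \bar R} :=
  density_measure planar_lebesgue measurable_gauss_weight gauss_weight_ge0.

(* |g|^2 dgauss *)
Definition weighted_gauss (g : R[i] -> R[i]) (mg : measurable_fun setT g) :
    {measure set R[i] -> \bar R} :=
  density_measure gauss (measurable_sqr_normc mg)
    (fun z => sqr_ge0 (normc (g z))).

End planar_measures.
Arguments planar_lebesgue {R}.
Arguments gauss {R}.

Section bargmann.
Variable R : realType.
Local Notation C := R[i].
Implicit Types (f g h u : C -> C) (m : {measure set C -> \bar R}).

Definition complex_integral m f : C :=
  (\int[m]_z complex.Re (f z)) +i* (\int[m]_z complex.Im (f z)).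

Definition sqr_integral m f : \bar R := (\int[m]_z (normc (f z) ^+ 2)%:E)%E.

(* Meaningful on [L2] only ([fine] sends +oo to 0). *)
Definition gauss_norm f : R := Num.sqrt (fine (sqr_integral gauss f)).

Definition gauss_inner f h : C := complex_integral gauss (fun z => f z * (h z)^*).

(* Square-integrable functions, not their classes modulo null sets. *)
Definition L2 : set (C -> C) :=
  [set f | measurable_fun setT f /\ (sqr_integral gauss f < +oo)%E].

Definition entire f : Prop := forall z, derivable f z 1.

Definition F2 : set (C -> C) :=
  [set f | entire f /\ (sqr_integral gauss f < +oo)%E].

(* Orthogonal projection of L2 onto F2. *)
Definition bargmann_proj f : C -> C :=
  get [set u | F2 u /\ forall h, F2 h -> gauss_inner (f \- u) h = 0].

Definition mul_domain g : set (C -> C) := [set f | L2 f /\ L2 (g \* f)].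

Definition U_op g f : C -> C := bargmann_proj (g \* f).

(* A bounded linear [T] from a subspace [V] of L2 to F2; being linear and
   bounded, it sends functions equal almost everywhere to the same element
   of F2. *)
Definition bounded_operator (V : set (C -> C)) (T : (C -> C) -> (C -> C)) :=
  [/\ forall f, V f -> F2 (T f),
      forall (a : C) f h, V f -> V h ->
        T (fun z => a * f z + h z) = (fun z => a * T f z + T h z)
    & exists K : R, forall f, V f -> gauss_norm (T f) <= K * gauss_norm f].

Definition U_extends_boundedly g : Prop :=
  exists T, bounded_operator L2 T /\
    forall f, mul_domain g f -> T f = U_op g f.

Definition mul_bounded g : Prop :=
  exists2 K : R, 0 < K &
    forall h, F2 h ->
      (\int[gauss]_z (normc (g z) ^+ 2 * normc (h z) ^+ 2)%:E
         <= K%:E * sqr_integral gauss h)%E.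

Definition fock_carleson m : Prop :=
  exists2 K : R, 0 < K &
    forall h, F2 h -> (sqr_integral m h <= K%:E * sqr_integral gauss h)%E.

Definition expC (z : C) : C :=
  (expR (complex.Re z))%:C * (cos (complex.Im z) +i* sin (complex.Im z)).

Definition normalized_kernel (a w : C) : C :=
  expC (w * a^* - (normc a ^+ 2 / 2)%:C).

Definition toeplitz_integrand g f h (z : C) : C :=
  (normc (g z) ^+ 2)%:C * f z * (h z)^*.

Definition toeplitz_form g f h : C :=
  complex_integral gauss (toeplitz_integrand g f h).

Definition toeplitz_form_converges g : Prop :=
  forall f h, F2 f -> F2 h ->
    gauss.-integrable setT (fun z => (normc (toeplitz_integrand g f h z))%:E).

Definition toeplitz_form_bounded g : Prop :=
  toeplitz_form_converges g /\
  exists K : R, forall f h, F2 f -> F2 h ->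
    normc (toeplitz_form g f h) <= K * gauss_norm f * gauss_norm h.

Definition induces_bounded_toeplitz_operator g : Prop :=
  toeplitz_form_converges g /\
  exists T, bounded_operator F2 T /\
    forall f h, F2 f -> F2 h -> gauss_inner (T f) h = toeplitz_form g f h.

End bargmann.

(* Main.v *)
From HB Require Import structures.
Require Import Defs.
From mathcomp Require Import all_boot all_order all_algebra.
From mathcomp Require Import complex.
From mathcomp Require Import all_classical all_reals all_analysis.
From mathcomp Require Import measurable_realfun ring lra.
Set Implicit Arguments.
Unset Strict Implicit.
Unset Printing Implicit Defensive.
Import Order.TTheory GRing.Theory Num.Theory.
Import numFieldNormedType.Exports.
Local Open Scope classical_set_scope.
Local Open Scope ring_scope.
Local Open Scope complex_scope.
(* [ring_scope] is put back on top so that a postfixed star is everywhere the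
   conjugation [Num.conj] rather than the convertible [conjc]. *)
Local Open Scope ring_scope.

(** Everything reduces to one fact: if the Berezin transform of [|g|^2], the
    integrals of [|g|^2] against squared normalized kernels, is bounded, then the
    integral operator [kernel_op g] with kernel [g(w) e^(z w')] ([w'] the
    conjugate of [w]) maps [L2] boundedly into [F2], and its adjoint is
    multiplication by the conjugate of [g].

    Boundedness is Schur's test ([schur_test]). The test function
    [e^(|w|^2 / 2)] times the modulus of the kernel is a Gaussian average of the
    exponentials [e^(2 Re (w a'))], so that its integral against [|g|^2] is
    controlled by the Berezin transform ([berezin_kernel_test]); the case [g = 1]
    ([integral_kernel_test]) gives the other half of the test. The values of the
    operator are entire by differentiation under the integral sign
    ([entire_cint_kernel]). The adjoint formula ([kernel_op_adjoint]) is Fubini's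
    theorem together with the reproducing property ([reproducing]) of the kernel
    [e^(z w')]. For [g = 1] these facts make [kernel_op] the orthogonal projection
    onto [F2] ([bargmann_projE]); hence [kernel_op g] extends [U_g] as soon as the
    Berezin transform is bounded.

    Conversely, if [T] extends [U_g], testing it on [f_n], the product of [h] and
    the conjugate of [g] cut off where [|g| > n], gives
    [|f_n|^2 = <T f_n, h> <= |T| |f_n| |h|]; letting [n] tend to infinity,
    multiplication by [g] is bounded on [F2]. The latter is the Carleson
    inequality, which for normalized kernels bounds the Berezin transform. The
    Toeplitz form is bounded when multiplication by [g] is, by the Cauchy-Schwarz
    inequality, and the choice [f = h] gives the converse; the Toeplitz operator
    is multiplication by [g] followed by the kernel operator of its conjugate.

    The reproducing property rests on the mean value property of entire
    functions for the Gaussian measure. Goursat's theorem on rectangles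
    ([goursat]), applied to the [2 pi i]-periodic function [w |-> h (e^w z)],
    gives the mean value property on circles ([circle_mean]) from pointwise
    complex differentiability alone. Averaging the rotation invariance of the
    Gaussian measure, a rotation of the plane being a product of shears, over
    all angles gives the mean value at the origin ([gauss_mean_value]), and a
    translation of the plane moves it to any point. *)

(** * Complex numbers and the exponential *)

Section complex_basics.
Variable R : realType.
Local Notation C := R[i].
Implicit Types z w : C.

(* Several facts that follow are known for the normed module [Rcomplex R]; they
   are restated on [R[i]], where they can be used for rewriting. *)
Lemma sqr_normcE z : normc z ^+ 2 = complex.Re z ^+ 2 + complex.Im z ^+ 2.
Proof. by case: z => a b /=; rewrite sqr_sqrtr// addr_ge0// sqr_ge0. Qed.

Lemma normc_ge0 z : 0 <= normc z.
Proof. by case: z => a b; exact: sqrtr_ge0. Qed.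
Hint Resolve normc_ge0 : core.

Lemma normcM z w : normc (z * w) = normc z * normc w.
Proof. exact: ComplexField.Normc.normcM. Qed.

Lemma normcD z w : normc (z + w) <= normc z + normc w.
Proof. exact: le_normcD. Qed.

Lemma normc_opp z : normc (- z) = normc z.
Proof. exact: normcN. Qed.

Lemma normcB z w : normc (z - w) <= normc z + normc w.
Proof. by rewrite -(normc_opp w) normcD. Qed.

Lemma normc_conj z : normc z^* = normc z.
Proof. by case: z => a b /=; rewrite sqrrN. Qed.

Lemma normc_real (x : R) : normc x%:C = `|x|.
Proof. by rewrite /= expr0n addr0 sqrtr_sqr. Qed.

Lemma normc_zero : normc (0 : C) = 0.
Proof. exact: ComplexField.Normc.normc0. Qed.

Lemma normc_one : normc (1 : C) = 1.
Proof. exact: ComplexField.Normc.normc1. Qed.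

Lemma normc_eq0 z : normc z = 0 -> z = 0.
Proof. exact: ComplexField.Normc.eq0_normc. Qed.

Lemma ler_Re_normc z : `|complex.Re z| <= normc z.
Proof.
rewrite -(ler_pXn2r (n := 2))// ?nnegrE// sqr_normcE.
by rewrite real_normK ?num_real// lerDl sqr_ge0.
Qed.

Lemma ler_Im_normc z : `|complex.Im z| <= normc z.
Proof.
rewrite -(ler_pXn2r (n := 2))// ?nnegrE// sqr_normcE.
by rewrite real_normK ?num_real// lerDr sqr_ge0.
Qed.

Lemma ler_normc_ReIm z : normc z <= `|complex.Re z| + `|complex.Im z|.
Proof.
rewrite -(ler_pXn2r (n := 2))// ?nnegrE ?addr_ge0// sqr_normcE sqrrD.
rewrite !real_normK ?num_real// -addrA [leRHS]addrA -addrA lerD2l.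
by rewrite addrC lerDl mulrn_wge0// mulr_ge0.
Qed.

Lemma ReD z w : complex.Re (z + w) = complex.Re z + complex.Re w.
Proof. by case: z; case: w. Qed.
Lemma ImD z w : complex.Im (z + w) = complex.Im z + complex.Im w.
Proof. by case: z; case: w. Qed.
Lemma ReN z : complex.Re (- z) = - complex.Re z.
Proof. by case: z. Qed.
Lemma ImN z : complex.Im (- z) = - complex.Im z.
Proof. by case: z. Qed.
Lemma ReM z w : complex.Re (z * w) =
  complex.Re z * complex.Re w - complex.Im z * complex.Im w.
Proof. by case: z; case: w. Qed.
Lemma ImM z w : complex.Im (z * w) =
  complex.Re z * complex.Im w + complex.Im z * complex.Re w.
Proof. by case: z; case: w. Qed.
Lemma Re_conj z : complex.Re z^* = complex.Re z.
Proof. by case: z. Qed.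
Lemma Im_conj z : complex.Im z^* = - complex.Im z.
Proof. by case: z. Qed.

Lemma complexP z w : complex.Re z = complex.Re w ->
  complex.Im z = complex.Im w -> z = w.
Proof. by case: z; case: w => a b c d /= -> ->. Qed.

Lemma expCD z w : expC (z + w) = expC z * expC w.
Proof.
rewrite /expC ReD ImD expRD cosD sinD.
by apply: complexP; rewrite !(ReM, ImM) /=; ring.
Qed.

Lemma expC0 : expC (0 : C) = 1.
Proof.
rewrite /expC /= expR0 cos0 sin0.
by apply: complexP; rewrite !(ReM, ImM) /=; ring.
Qed.

Lemma normc_expC z : normc (expC z) = expR (complex.Re z).
Proof.
rewrite /expC normcM normc_real ger0_norm ?expR_ge0//=.
by rewrite cos2Dsin2 sqrtr1 mulr1.
Qed.

Lemma expC_conj z : (expC z)^* = expC z^*.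
Proof.
rewrite /expC Re_conj Im_conj cosN sinN.
by apply: complexP; rewrite ?(Re_conj,Im_conj) !(ReM, ImM) /=; ring.
Qed.

End complex_basics.
#[export] Hint Extern 0 (is_true (0 <= normc _)) => exact: normc_ge0 : core.

Section exp_taylor.
Variable R : realType.
Local Notation C := R[i].

(* The real part of [(p + i q) e^(t (x + i y))]; its derivative in [t] has the
   same form, [p + i q] being multiplied by [x + i y]. *)
Let F (x y p q t : R) := expR (t * x) * (p * cos (t * y) - q * sin (t * y)).

Let dF (x y p q t : R) :
  is_derive t 1 (F x y p q) (F x y (p * x - q * y) (p * y + q * x) t).
Proof.
have d1 (k : R) : is_derive t 1 (fun t : R => t * k) k.
  have -> : (fun t : R => t * k) = k *: (id : R -> R).
    by apply/funext => u /=; rewrite /GRing.scale /= mulrC.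
  by apply: is_derive_eq; rewrite /GRing.scale /= mulr1.
have de : is_derive t 1 (fun t : R => expR (t * x)) (expR (t * x) * x).
  exact: (@is_derive1_comp _ expR (fun t : R => t * x) t _ _ (is_derive_expR _) (d1 x)).
have dc : is_derive t 1 (fun t : R => cos (t * y)) (- sin (t * y) * y).
  exact: (@is_derive1_comp _ cos (fun t : R => t * y) t _ _ (is_derive_cos _) (d1 y)).
have ds : is_derive t 1 (fun t : R => sin (t * y)) (cos (t * y) * y).
  exact: (@is_derive1_comp _ sin (fun t : R => t * y) t _ _ (is_derive_sin _) (d1 y)).
rewrite /F.
have -> : (fun t : R => expR (t * x) * (p * cos (t * y) - q * sin (t * y))) =
  (fun t : R => expR (t * x)) * (p *: (fun t : R => cos (t * y)) -
    q *: (fun t : R => sin (t * y))) by [].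
apply: is_derive_eq.
rewrite !fctE /GRing.scale /=; ring.
Qed.

Let bF (x y p q t : R) : 0 <= t <= 1 ->
  `|F x y p q t| <= normc (p +i* q) * expR (normc (x +i* y)).
Proof.
move=> /andP[t0 t1].
have -> : F x y p q t = complex.Re ((p +i* q) * expC (t%:C * (x +i* y))).
  by rewrite /F /expC /= !(mul0r, subr0, addr0); ring.
apply: (le_trans (ler_Re_normc _)); rewrite normcM normc_expC.
rewrite ler_wpM2l// ler_expR ReM /= mul0r subr0.
apply: (@le_trans _ _ (t * normc (x +i* y))).
  by rewrite ler_wpM2l// (le_trans (ler_norm _))// (ler_Re_normc (x +i* y)).
by rewrite ler_piMl.
Qed.

Let taylorF (x y p q : R) :
  `|F x y p q 1 - F x y p q 0 - F x y (p * x - q * y) (p * y + q * x) 0| <=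
  normc ((p +i* q) * (x +i* y) ^+ 2) * expR (normc (x +i* y)).
Proof.
have MVTF a b t : 0 < t -> t <= 1 -> exists2 c, 0 <= c <= 1 &
    F x y a b t - F x y a b 0 = F x y (a * x - b * y) (a * y + b * x) c * t.
  move=> t0 t1.
  have [c||c] := @MVT R (F x y a b) (F x y (a * x - b * y) (a * y + b * x)) 0 t t0.
  - by move=> _; exact: dF.
  - apply: continuous_subspaceT => u.
    by apply: differentiable_continuous; apply/derivable1_diffP;
      have [] := dF x y a b u.
  - rewrite in_itv/= subr0 => /andP[c0 ct] ->; exists c => //.
    by rewrite (ltW c0) (le_trans (ltW ct)).
have [c /andP[c0 c1] ->] := MVTF p q 1 ltr01 (lexx _); rewrite mulr1.
have [->|cneq] := eqVneq c 0.
  by rewrite subrr normr0 mulr_ge0 ?expR_ge0.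
have [|d /andP[d0 d1] ->] := MVTF (p * x - q * y) (p * y + q * x) c _ c1.
  by rewrite lt_neqAle eq_sym cneq.
rewrite normrM (ger0_norm c0); apply: (@le_trans _ _ (_ * 1)).
  exact: (ler_wpM2l _ c1).
rewrite mulr1 (le_trans (bF _ _ _ _ _))// ?d0//.
rewrite le_eqVlt; apply/orP; left; apply/eqP; congr (_ * _); congr normc.
by apply: complexP; rewrite /=; ring.
Qed.

(** The remainder of order two of the exponential: the mean value theorem,
    twice, for the real and imaginary parts of [t |-> e^(t z)]. *)
Lemma expC_taylor (z : C) :
  normc (expC z - 1 - z) <= 2 * normc z ^+ 2 * expR (normc z).
Proof.
case: z => x y; apply: (le_trans (ler_normc_ReIm _)).
have := taylorF x y 1 0; have := taylorF x y 0 (-1).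
have E (p q : R) : normc ((p +i* q) * (x +i* y) ^+ 2) =
    normc (p +i* q) * normc (x +i* y) ^+ 2.
  by rewrite normcM [in LHS]expr2 normcM -expr2.
rewrite /F !E !mul1r !mul0r !subr0 !expR0 !cos0 !sin0 !sub0r !mul1r !mulr1.
rewrite ?mulr0 ?addr0 ?subr0.
rewrite !(mulNr, mul1r, opprK, mulr0, subr0, add0r, addr0).
have -> : normc (0 +i* -1 : C) = 1 by rewrite /= sqrrN expr0n expr1n add0r sqrtr1.
have -> : normc (1 +i* 0 : C) = 1 by rewrite /= expr0n expr1n addr0 sqrtr1.
rewrite !mul1r => h1 h2.
have -> : 2 * normc (x +i* y) ^+ 2 * expR (normc (x +i* y)) =
   normc (x +i* y) ^+ 2 * expR (normc (x +i* y)) +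
   normc (x +i* y) ^+ 2 * expR (normc (x +i* y)).
  by ring.
apply: lerD.
  by move: h2; congr (`| _ | <= _); rewrite /expC !(ReD,ReN,ReM) /=; ring.
by move: h1; congr (`| _ | <= _); rewrite /expC !(ImD,ImN,ImM) /=; ring.
Qed.

End exp_taylor.

(** * Complex derivatives *)

Section cderiv.
Variable R : realType.
Local Notation C := R[i].
Implicit Types (f g h : C -> C) (z w d : C).

(** [d] is the complex derivative of [f] at [z], with moduli in [R]. *)
Definition cderiv f z d : Prop := forall e : R, 0 < e ->
  exists2 r : R, 0 < r & forall w, normc w < r ->
    normc (f (z + w) - f z - d * w) <= e * normc w.

Lemma normCE z : `|z| = (normc z)%:C.
Proof. by []. Qed.

Lemma gt0_complexE (e : C) : 0 < e -> 0 < complex.Re e /\ e = (complex.Re e)%:C.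
Proof.
rewrite ltcE /= => /andP[/eqP r0 ?]; split => //.
exact: complexP.
Qed.

Lemma derivable_cderiv f z : derivable f z 1 -> exists d, cderiv f z d.
Proof.
move=> /derivable_nbhs /eqaddoP H; exists ('D_1 f z) => e e0.
have := H e%:C; rewrite ltcR => /(_ e0) /nbhs_normP[r /= r0 rP].
have [r'0 rE] := gt0_complexE r0.
exists (complex.Re r) => // w wr.
have /= := rP w; rewrite sub0r normrN normCE {1}rE ltcR => /(_ wr).
have -> : ((fun h : C => f (h *: (1 : C^o) + z)) - (cst (f z) + *:%R^~ ('D_1 f z))) w =
  f (z + w) - f z - 'D_1 f z * w.
  by rewrite !fctE /GRing.scale /= mulr1 (addrC w) opprD addrA mulrC.
by rewrite normCE -rmorphM lecR.
Qed.

Lemma cderiv_derivable f z d : cderiv f z d -> derivable f z 1.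
Proof.
move=> fz; apply: (cvgP d); apply/cvgrPdist_le => e /gt0_complexE[e0 eE].
have [r r0 rP] := fz _ e0.
rewrite near_withinE; apply/nbhs_normP; exists r%:C; rewrite /= ?ltcR//.
move=> w /=; rewrite sub0r normrN normCE ltcR => wr w0.
have -> : d - w^-1 *: ((f \o shift z) (w *: (1 : C^o)) - f z) =
   - (w^-1 * (f (z + w) - f z - d * w)).
  rewrite /= /GRing.scale /= mulr1 (addrC w).
  set a := f _; set b := f _; move: (a) (b) => {}a {}b; move: w0 => /= w0.
  have -> : (- (w^-1 * (a - b - d * w)) = (w^-1 * w) * d - w^-1 * (a - b)) by ring.
  by rewrite mulVf// mul1r.
rewrite normrN normCE eE lecR normcM.
have nw0 : 0 < normc w.
  by rewrite lt_neqAle normc_ge0 andbT eq_sym; apply: contra_neq w0 => /normc_eq0.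
have := rP _ wr; rewrite -ler_pdivrMr// mulrC.
by have -> : normc w^-1 = (normc w)^-1 by exact: ComplexField.Normc.normcV.
Qed.

Lemma entire_cderiv f z : entire f -> exists d, cderiv f z d.
Proof. by move=> /(_ z) /derivable_cderiv. Qed.

Lemma entireM f g : entire f -> entire g -> entire (fun z => f z * g z).
Proof. by move=> ef eg z; exact: (derivableM (ef z) (eg z)). Qed.

Lemma entireD f g : entire f -> entire g -> entire (fun z => f z + g z).
Proof. by move=> ef eg z; exact: (derivableD (ef z) (eg z)). Qed.

Lemma entire_cst (c : C) : entire (fun=> c).
Proof. by move=> z; exact: derivable_cst. Qed.

Lemma entire_id : entire (fun z : C => z).
Proof. by move=> z; exact: (@derivable_id _ C^o). Qed.

Lemma entire_comp f g : entire f -> entire g -> entire (fun z => f (g z)).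
Proof.
move=> ef eg z; apply/derivable1_diffP.
by apply: (@differentiable_comp _ _ _ _ g f); apply/derivable1_diffP.
Qed.

(** A remainder of order two gives the derivative. *)
Lemma cderiv_quadratic f z d (K : R) :
  (forall w, normc w < 1 -> normc (f (z + w) - f z - d * w) <= K * normc w ^+ 2) ->
  cderiv f z d.
Proof.
move=> fK e e0.
have K0 : 0 < `|K| + 1 by rewrite ltr_wpDl.
exists (Num.min 1 (e / (`|K| + 1))); first by rewrite lt_min ltr01 divr_gt0.
move=> w; rewrite lt_min => /andP[w1 we].
apply: (le_trans (fK _ w1)); rewrite expr2 mulrA ler_wpM2r//.
apply: (@le_trans _ _ ((`|K| + 1) * normc w)).
  by rewrite ler_wpM2r// (le_trans (ler_norm _))// lerDl.
by rewrite mulrC -ler_pdivlMr// ltW.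
Qed.

Lemma entire_expC : entire (@expC R).
Proof.
move=> z; apply: (@cderiv_derivable _ _ (expC z)).
apply: (@cderiv_quadratic _ _ _ (expR (complex.Re z) * (2 * expR 1))) => w w1.
have -> : expC (z + w) - expC z - expC z * w = expC z * (expC w - 1 - w).
  by rewrite expCD; ring.
rewrite normcM normc_expC -mulrA ler_wpM2l ?expR_ge0//.
apply: (le_trans (expC_taylor _)).
by rewrite -[leRHS]mulrAC ler_wpM2l ?mulr_ge0 ?sqr_ge0// ler_expR ltW.
Qed.

(** The epsilon-delta form of continuity that a complex derivative gives. *)
Lemma entire_cvg f z : entire f -> forall e : R, 0 < e ->
  exists2 r : R, 0 < r & forall w, normc w < r -> normc (f (z + w) - f z) < e.
Proof.
move=> /(entire_cderiv z)[d fz] e e0; have [r r0 rP] := fz 1 ltr01.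
have d0 : 0 < normc d + 1 by rewrite ltr_wpDl.
exists (Num.min r (e / (normc d + 1))); first by rewrite lt_min r0 divr_gt0.
move=> w; rewrite lt_min => /andP[wr we].
have -> : f (z + w) - f z = f (z + w) - f z - d * w + d * w by rewrite subrK.
apply: (le_lt_trans (normcD _ _)); rewrite normcM.
apply: (@le_lt_trans _ _ (1 * normc w + normc d * normc w)).
  by rewrite lerD2r rP.
by rewrite -mulrDl mulrC addrC -ltr_pdivlMr.
Qed.

End cderiv.

(** * Integrals over segments *)

Section segment_integral.
Variable R : realType.
Local Notation C := R[i].
Local Notation lambda := (@lebesgue_measure R).
Implicit Types (f g : R -> C) (G : C -> C).

(** The integral of a complex function of a real variable over [a, b]. *)
Definition cseg (a b : R) f : C :=
  (\int[lambda]_(x in `[a, b]) complex.Re (f x)) +i*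
  (\int[lambda]_(x in `[a, b]) complex.Im (f x)).

(** Continuity of a complex function of a real variable, by components. *)
Definition ccont f : Prop :=
  continuous (fun t => complex.Re (f t)) /\ continuous (fun t => complex.Im (f t)).

Lemma continuous_integrable_itv (u : R -> R) a b : continuous u ->
  lambda.-integrable `[a, b] (EFin \o u).
Proof.
move=> cu; apply: continuous_compact_integrable; first exact: segment_compact.
exact: continuous_subspaceT.
Qed.

Lemma ccontD f g : ccont f -> ccont g -> ccont (fun t => f t + g t).
Proof.
move=> [f1 f2] [g1 g2]; split.
  by under eq_fun do rewrite ReD; move=> t; apply: cvgD; [exact: f1|exact: g1].
by under eq_fun do rewrite ImD; move=> t; apply: cvgD; [exact: f2|exact: g2].
Qed.

Lemma ccontN f : ccont f -> ccont (fun t => - f t).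
Proof.
move=> [f1 f2]; split.
  by under eq_fun do rewrite ReN; move=> t; apply: cvgN; exact: f1.
by under eq_fun do rewrite ImN; move=> t; apply: cvgN; exact: f2.
Qed.

Lemma csegD a b f g : ccont f -> ccont g ->
  cseg a b (fun t => f t + g t) = cseg a b f + cseg a b g.
Proof.
move=> [f1 f2] [g1 g2]; apply: complexP; rewrite ?(ReD, ImD) /cseg /=.
  rewrite -RintegralD//; try exact: continuous_integrable_itv.
  by apply: eq_Rintegral => x _; rewrite ReD.
rewrite -RintegralD//; try exact: continuous_integrable_itv.
by apply: eq_Rintegral => x _; rewrite ImD.
Qed.

Arguments continuous_integrable_itv [u] a b _.

Let Rsplit (u : R -> R) a b c : a <= b -> b <= c -> continuous u ->
  \int[lambda]_(x in `[a, c]) u x =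
  \int[lambda]_(x in `[a, b]) u x + \int[lambda]_(x in `[b, c]) u x.
Proof.
move=> ab bc cu; have := @Rintegral_itvB R u (BLeft a) (BRight c) b
  (continuous_integrable_itv a c cu).
rewrite !bnd_simp => /(_ ab bc) /eqP; rewrite subr_eq => /eqP ->.
rewrite addrC; congr (_ + _).
apply: Rintegral_itv_obnd_cbnd.
apply: integrableS (continuous_integrable_itv b c cu) => //.
exact: subset_itv_oc_cc.
Qed.

Lemma cseg_split a b c f : a <= b -> b <= c -> ccont f ->
  cseg a c f = cseg a b f + cseg b c f.
Proof.
by move=> ab bc [f1 f2]; apply: complexP; rewrite ?(ReD, ImD) /cseg /=; exact: Rsplit.
Qed.

Let Rnear (u : R -> R) a b k M : a <= b -> continuous u ->
  (forall x, a <= x <= b -> `|u x - k| <= M) ->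
  `|\int[lambda]_(x in `[a, b]) u x - (b - a) * k| <= M * (b - a).
Proof.
move=> ab cu uM.
have icst r : \int[lambda]_(x in `[a, b]) r = r * (b - a).
  rewrite Rintegral_cst//= lebesgue_measure_itv/= lte_fin.
  case: ifPn => // /negbTE; rewrite lt_neqAle ab andbT => /negbFE/eqP ->.
  by rewrite subrr mulr0.
rewrite mulrC -icst -RintegralB//; first last.
- by apply: continuous_integrable_itv => x; exact: cvg_cst.
- exact: continuous_integrable_itv.
have cuk : continuous (fun x => u x - k).
  by move=> x; apply: cvgB; [exact: cu|exact: cvg_cst].
apply: (le_trans (le_normr_Rintegral _ _)) => //.
  exact: continuous_integrable_itv.
rewrite -icst; apply: le_Rintegral => //.
- apply: continuous_integrable_itv => x; apply: cvg_norm; exact: cuk.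
- by apply: continuous_integrable_itv => x; exact: cvg_cst.
Qed.

(** An integral is close to the length times any constant that the integrand
    is close to; the factor 2 comes from bounding the components separately. *)
Lemma cseg_near a b f k M : a <= b -> ccont f ->
  (forall x, a <= x <= b -> normc (f x - k) <= M) ->
  normc (cseg a b f - (b - a)%:C * k) <= 2 * M * (b - a).
Proof.
move=> ab [f1 f2] fM; apply: (le_trans (ler_normc_ReIm _)).
rewrite !(ReD, ImD, ReN, ImN, ReM, ImM) /= !mul0r subr0 addr0.
have -> : 2 * M * (b - a) = M * (b - a) + M * (b - a) by ring.
apply: lerD; apply: Rnear => // x /fM; apply: le_trans.
  by apply: le_trans (ler_Re_normc _); rewrite ReD ReN.
by apply: le_trans (ler_Im_normc _); rewrite ImD ImN.
Qed.

Lemma entire_ccont G (p q : C) : entire G -> ccont (fun t => G (p + t%:C * q)).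
Proof.
move=> eG.
have H (t e : R) : 0 < e -> \forall s \near t,
    normc (G (p + t%:C * q) - G (p + s%:C * q)) < e.
  move=> e0; have [r r0 rP] := entire_cvg (p + t%:C * q) eG e0.
  have q0 : 0 < normc q + 1 by rewrite ltr_wpDl.
  have rq : 0 < r / (normc q + 1) by rewrite divr_gt0.
  near=> s; rewrite -normc_opp opprB.
  have -> : p + s%:C * q = p + t%:C * q + (s - t)%:C * q by rewrite rmorphB/=; ring.
  apply: rP; rewrite normcM normc_real.
  apply: (@le_lt_trans _ _ (`|s - t| * (normc q + 1))).
    by rewrite ler_wpM2l// lerDl.
  rewrite -ltr_pdivlMr// distrC; near: s.
split=> t; apply/cvgrPdist_lt => e e0; near=> s.
  rewrite -ReN -ReD; apply: (le_lt_trans (ler_Re_normc _)).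
  by near: s; exact: H.
rewrite -ImN -ImD; apply: (le_lt_trans (ler_Im_normc _)).
by near: s; exact: H.
Unshelve. all: by end_near.
Qed.

End segment_integral.

(** * Goursat's theorem on rectangles *)

Local Arguments ComplexField.Normc.normc : simpl never.

Section goursat.
Variable R : realType.
Local Notation C := R[i].
Local Notation "`i" := ('i%C : C).
Implicit Types (f g : R -> C) (G : C -> C).

(** The integral of [G] along the boundary of [a, b] x [c, d], with the
    integrals over opposite sides put under one sign. *)
Definition box_integral G (a b c d : R) : C :=
  cseg a b (fun x => G (x +i* c) - G (x +i* d)) +
  'i%C * cseg c d (fun y => G (b +i* y) - G (a +i* y)).

Arguments box_integral : simpl never.

Lemma entire_ccont_hor G c : entire G -> ccont (fun x => G (x +i* c)).
Proof.
move=> eG; have := entire_ccont (0 +i* c) (1 : C) eG.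
congr (ccont _); apply/funext => x; congr G.
by apply: complexP; rewrite !(ReD, ImD, ReM, ImM) /=; ring.
Qed.

Lemma entire_ccont_ver G a : entire G -> ccont (fun y => G (a +i* y)).
Proof.
move=> eG; have := entire_ccont (a%:C) ('i%C : C) eG.
congr (ccont _); apply/funext => x; congr G.
by apply: complexP; rewrite !(ReD, ImD, ReM, ImM) /=; ring.
Qed.

Lemma box_integral_splitl G a m b c d : entire G -> a <= m -> m <= b ->
  box_integral G a b c d = box_integral G a m c d + box_integral G m b c d.
Proof.
move=> eG am mb; rewrite /box_integral.
rewrite (cseg_split am mb); last first.
  by apply: ccontD; [|apply: ccontN]; exact: entire_ccont_hor.
have -> : (fun y => G (b +i* y) - G (a +i* y)) =
  (fun y => (G (m +i* y) - G (a +i* y)) + (G (b +i* y) - G (m +i* y))).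
  by apply/funext => y; ring.
rewrite (@csegD _ c d (fun y => G (m +i* y) - G (a +i* y))); first by ring.
  by apply: ccontD; [|apply: ccontN]; exact: entire_ccont_ver.
by apply: ccontD; [|apply: ccontN]; exact: entire_ccont_ver.
Qed.

Lemma box_integral_splitr G a b c m d : entire G -> c <= m -> m <= d ->
  box_integral G a b c d = box_integral G a b c m + box_integral G a b m d.
Proof.
move=> eG am mb; rewrite /box_integral.
rewrite (cseg_split am mb); last first.
  by apply: ccontD; [|apply: ccontN]; exact: entire_ccont_ver.
have -> : (fun y => G (y +i* c) - G (y +i* d)) =
  (fun y => (G (y +i* c) - G (y +i* m)) + (G (y +i* m) - G (y +i* d))).
  by apply/funext => y; ring.
rewrite (@csegD _ a b (fun y => G (y +i* c) - G (y +i* m))); first by ring.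
  by apply: ccontD; [|apply: ccontN]; exact: entire_ccont_hor.
by apply: ccontD; [|apply: ccontN]; exact: entire_ccont_hor.
Qed.

(** Affine functions have zero boundary integral, so on a small box [G] may
    be replaced by the error term of its first order expansion. *)
Lemma box_integral_small G a b c d z k e : entire G -> a <= b -> c <= d ->
  a <= complex.Re z <= b -> c <= complex.Im z <= d ->
  (forall w, normc (w - z) <= (b - a) + (d - c) ->
    normc (G w - G z - k * (w - z)) <= e * normc (w - z)) -> 0 <= e ->
  normc (box_integral G a b c d) <= 4 * e * ((b - a) + (d - c)) ^+ 2.
Proof.
move=> eG ab cd /andP[az zb] /andP[cz zd] Gz e0.
set D := (b - a) + (d - c).
have near w : a <= complex.Re w <= b -> c <= complex.Im w <= d ->
    normc (G w - G z - k * (w - z)) <= e * D.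
  move=> /andP[aw wb] /andP[cw wd].
  have wz : normc (w - z) <= D.
    apply: (le_trans (ler_normc_ReIm _)); rewrite ReD ImD ReN ImN.
    by apply: lerD; rewrite ler_norml; apply/andP; split; lra.
  by rewrite (le_trans (Gz _ wz))// ler_wpM2l.
have hor : normc (cseg a b (fun x => G (x +i* c) - G (x +i* d)) -
    (b - a)%:C * (- k * (d - c)%:C * 'i%C)) <= 2 * (2 * (e * D)) * (b - a).
  apply: cseg_near => //.
    by apply: ccontD; [|apply: ccontN]; exact: entire_ccont_hor.
  move=> x axb.
  have -> : G (x +i* c) - G (x +i* d) - (- k * (d - c)%:C * 'i%C) =
    (G (x +i* c) - G z - k * (x +i* c - z)) -
    (G (x +i* d) - G z - k * (x +i* d - z)).
    rewrite [x +i* d]complexE [x +i* c]complexE /= rmorphB /=; ring.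
  rewrite (le_trans (normcB _ _))// mulr2n mulrDl !mul1r lerD// near//=.
    by rewrite lexx.
  by rewrite lexx andbT.
have ver : normc (cseg c d (fun y => G (b +i* y) - G (a +i* y)) -
    (d - c)%:C * (k * (b - a)%:C)) <= 2 * (2 * (e * D)) * (d - c).
  apply: cseg_near => //.
    by apply: ccontD; [|apply: ccontN]; exact: entire_ccont_ver.
  move=> x axb.
  have -> : G (b +i* x) - G (a +i* x) - (k * (b - a)%:C) =
    (G (b +i* x) - G z - k * (b +i* x - z)) -
    (G (a +i* x) - G z - k * (a +i* x - z)).
    rewrite [b +i* x]complexE [a +i* x]complexE /= rmorphB /=; ring.
  rewrite (le_trans (normcB _ _))// mulr2n mulrDl !mul1r lerD// near//=.
    by rewrite lexx andbT.
  by rewrite lexx.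
have -> : box_integral G a b c d =
   (cseg a b (fun x => G (x +i* c) - G (x +i* d)) -
    (b - a)%:C * (- k * (d - c)%:C * 'i%C)) +
   'i%C * (cseg c d (fun y => G (b +i* y) - G (a +i* y)) -
    (d - c)%:C * (k * (b - a)%:C)).
  by rewrite /box_integral; ring.
apply: (le_trans (normcD _ _)); rewrite normcM.
have -> : normc ('i%C : C) = 1 
  by rewrite /ComplexField.Normc.normc expr0n expr1n add0r sqrtr1.
rewrite mul1r (le_trans (lerD hor ver))//.
by rewrite -mulrDr -/D le_eqVlt; apply/orP; left; apply/eqP; ring.
Qed.

Lemma nested_point (u v : nat -> R) :
  (forall n, u n <= u n.+1) -> (forall n, v n.+1 <= v n) ->
  (forall n, u n <= v n) -> exists x, forall n, u n <= x <= v n.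
Proof.
move=> u1 v1 uv.
have nu : nondecreasing_seq u by exact/nondecreasing_seqP.
have nv : nonincreasing_seq v by exact/nonincreasing_seqP.
have ub n : ubound (range u) (v n).
  move=> _ [m _ <-]; apply: (@le_trans _ _ (u (maxn m n))).
    by apply: nu; exact: leq_maxl.
  by apply: (le_trans (uv _)); apply: nv; exact: leq_maxr.
exists (sup (range u)) => n; apply/andP; split.
  by apply: ub_le_sup; [exists (v 0%N); exact: ub|exists n].
by apply: ge_sup; [exists (u 0%N); exists 0%N|exact: ub].
Qed.

(** Dependent choice with an invariant [P] and a transition relation [Q]. *)
Lemma dependent_choice_nat T (P : nat -> T -> Prop) (Q : nat -> T -> T -> Prop) x0 :
  P 0%N x0 -> (forall n x, P n x -> exists y, P n.+1 y /\ Q n x y) ->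
  exists s : nat -> T, forall n, P n (s n) /\ Q n (s n) (s n.+1).
Proof.
move=> P0 step.
have step' n (p : {x | P n x}) : {q : {x | P n.+1 x} | Q n (sval p) (sval q)}.
  by case: p => x Px; have [y [Py Qy]] := cid (step n x Px); exists (exist _ y Py).
pose s := nat_rect (fun n => {x | P n x}) (exist _ x0 P0) (fun n p => sval (step' n p)).
exists (fun n => sval (s n)) => n; split; first exact: (svalP (s n)).
exact: (svalP (step' n (s n))).
Qed.

(** Goursat: the rectangle is quartered repeatedly, keeping a quarter that
    carries at least a fourth of the boundary integral. *)
Lemma goursat G a b c d : entire G -> a <= b -> c <= d ->
  box_integral G a b c d = 0.
Proof.
move=> eG ab cd; apply: normc_eq0; apply/eqP; rewrite eq_le normc_ge0 andbT.
set W := normc _; set D := (b - a) + (d - c).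
have D0 : 0 <= D by rewrite addr_ge0// subr_ge0.
pose hx n : R := (b - a) / 2 ^+ n; pose hy n : R := (d - c) / 2 ^+ n.
have hx0 n : 0 <= hx n by rewrite divr_ge0 ?subr_ge0// exprn_ge0.
have hy0 n : 0 <= hy n by rewrite divr_ge0 ?subr_ge0// exprn_ge0.
have p2 n : (2 : R) ^+ n != 0 by rewrite expf_neq0.
have hxS n : hx n = hx n.+1 + hx n.+1.
  by rewrite /hx exprS; field; rewrite p2.
have hyS n : hy n = hy n.+1 + hy n.+1.
  by rewrite /hy exprS; field; rewrite p2.
pose P n (p : R * R) := W <= 4 ^+ n *
  normc (box_integral G p.1 (p.1 + hx n) p.2 (p.2 + hy n)).
pose Q n (p q : R * R) := [/\ p.1 <= q.1, q.1 + hx n.+1 <= p.1 + hx n,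
   p.2 <= q.2 & q.2 + hy n.+1 <= p.2 + hy n].
have P0 : P 0%N (a, c).
  by rewrite /P /hx /hy /= !expr0 !divr1 mul1r !subrKC.
have step n p : P n p -> exists q, P n.+1 q /\ Q n p q.
  case: p => x y; rewrite /P /Q /=.
  have hx1 := hx0 n.+1; have hy1 := hy0 n.+1.
  rewrite hxS hyS (addrA x) (addrA y).
  rewrite (@box_integral_splitl G x (x + hx n.+1))//; [|lra..].
  rewrite (@box_integral_splitr G x (x + hx n.+1) y (y + hy n.+1))//; [|lra..].
  rewrite (@box_integral_splitr G (x + hx n.+1) _ y (y + hy n.+1))//; [|lra..].
  set B1 := box_integral G x (x + hx n.+1) y (y + hy n.+1).
  set B2 := box_integral G x (x + hx n.+1) (y + hy n.+1) _.
  set B3 := box_integral G (x + hx n.+1) _ y (y + hy n.+1).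
  set B4 := box_integral G (x + hx n.+1) _ (y + hy n.+1) _.
  move=> WB.
  have {}WB : W <= 4 ^+ n * (normc B1 + normc B2 + (normc B3 + normc B4)).
    apply: (le_trans WB); rewrite ler_wpM2l ?exprn_ge0//.
    by apply: (le_trans (normcD _ _)); apply: lerD; exact: normcD.
  have {}WB : W / 4 ^+ n <= normc B1 + normc B2 + (normc B3 + normc B4).
    by rewrite ler_pdivrMr ?exprn_gt0// mulrC.
  have E t : (W <= 4 ^+ n.+1 * t) = (W / 4 ^+ n <= 4 * t).
    by rewrite ler_pdivrMr ?exprn_gt0// exprS mulrAC.
  have : [\/ W / 4 ^+ n <= 4 * normc B1, W / 4 ^+ n <= 4 * normc B2,
    W / 4 ^+ n <= 4 * normc B3 | W / 4 ^+ n <= 4 * normc B4].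
    apply: contrapT => H; 
    have : ~ W / 4 ^+ n <= 4 * normc B1 by move=> h; apply: H; constructor 1.
    have : ~ W / 4 ^+ n <= 4 * normc B2 by move=> h; apply: H; constructor 2.
    have : ~ W / 4 ^+ n <= 4 * normc B3 by move=> h; apply: H; constructor 3.
    have : ~ W / 4 ^+ n <= 4 * normc B4 by move=> h; apply: H; constructor 4.
    move=> /negP; rewrite -ltNge => h4 /negP; rewrite -ltNge => h3.
    move=> /negP; rewrite -ltNge => h2 /negP; rewrite -ltNge => h1.
    lra.
  case=> h.
  - by exists (x, y); split; [rewrite E; exact: h|split => /=; lra].
  - by exists (x, y + hy n.+1); split; [rewrite E; exact: h|split => /=; lra].
  - by exists (x + hx n.+1, y); split; [rewrite E; exact: h|split => /=; lra].
  - by exists (x + hx n.+1, y + hy n.+1); split;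
      [rewrite E; exact: h|split => /=; lra].
have [s sP] := dependent_choice_nat P0 step.
have [x xP] : exists x, forall n, (s n).1 <= x <= (s n).1 + hx n.
  by apply: nested_point => n; have [_ []] := sP n => //; rewrite lerDl.
have [y yP] : exists y, forall n, (s n).2 <= y <= (s n).2 + hy n.
  by apply: nested_point => n; have [_ []] := sP n => //; rewrite lerDl.
have [k Gk] := entire_cderiv (x +i* y) eG.
have Wsmall e : 0 < e -> W <= 4 * D ^+ 2 * e.
  move=> e0; have [r r0 rP] := Gk _ e0.
  have [n nr] : exists n, D / 2 ^+ n < r.
    exists (Num.bound (D / r)).
    have Dr : 0 <= D / r by rewrite divr_ge0// ltW.
    rewrite ltr_pdivrMr ?exprn_gt0// mulrC -ltr_pdivrMr//.
    apply: (lt_trans (archi_boundP Dr)).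
    by rewrite -natrX ltr_nat ltn_expl.
  have [Pn _] := sP n.
  apply: (le_trans Pn).
  have hD : hx n + hy n = D / 2 ^+ n by rewrite /hx /hy -mulrDl.
  have := @box_integral_small G (s n).1 ((s n).1 + hx n) (s n).2 ((s n).2 + hy n)
    (x +i* y) k e eG.
  rewrite !lerDl (hx0 n) (hy0 n) /= => /(_ isT isT (xP n) (yP n)).
  rewrite !(addrC (s n).1) !(addrC (s n).2) !addrK hD.
  have near w : normc (w - (x +i* y)) <= D / 2 ^+ n ->
      normc (G w - G (x +i* y) - k * (w - (x +i* y))) <= e * normc (w - (x +i* y)).
    move=> wn; have := rP (w - (x +i* y)) (le_lt_trans wn nr).
    by rewrite subrKC.
  move=> /(_ near (ltW e0)) BB.
  have e40 : 0 <= (4 : R) ^+ n by rewrite exprn_ge0.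
  have := ler_wpM2l e40 BB; rewrite !(addrC _ (s n).1) !(addrC _ (s n).2).
  move=> /le_trans; apply.
  have -> : (4 : R) ^+ n = (2 ^+ n) ^+ 2 by rewrite -exprM mulnC exprM expr2 -natrM.
  by rewrite le_eqVlt; apply/orP; left; apply/eqP; field; rewrite p2.
apply/ler_addgt0Pl => e e0; rewrite addr0.
have DD : 0 < 4 * D ^+ 2 + 1 by rewrite ltr_wpDl// mulr_ge0// sqr_ge0.
have := Wsmall (e / (4 * D ^+ 2 + 1)); rewrite divr_gt0// => /(_ isT).
move=> /le_trans; apply; rewrite mulrCA ger_pMr// ler_pdivrMr// mul1r.
by rewrite lerDl.
Qed.

End goursat.

(** * Mean values on circles *)

Section circle_mean.
Variable R : realType.
Local Notation C := R[i].
Implicit Types (H : C -> C).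

(** The mean value property on circles: [w |-> H (e^w z)] has period [2 pi i],
    so its integrals over the vertical sides [[A, A + 2 pi i]] do not depend
    on [A], and [A] can be sent to minus infinity. *)
Lemma circle_mean H z : entire H ->
  cseg 0 (pi *+ 2) (fun t => H (expC (0 +i* t) * z)) = (pi *+ 2)%:C * H 0.
Proof.
move=> eH; pose G w := H (expC w * z).
have eG : entire G.
  apply: (entire_comp eH); apply: entireM; first exact: entire_expC.
  exact: entire_cst.
have pi2 : 0 <= (pi : R) *+ 2 by rewrite mulrn_wge0// pi_ge0.
have const (a : R) : a <= 0 -> cseg 0 (pi *+ 2) (fun t => G (0 +i* t)) =
    cseg 0 (pi *+ 2) (fun t => G (a +i* t)).
  move=> a0; have := goursat eG a0 pi2; rewrite /box_integral.
  have -> : (fun x : R => G (x +i* 0) - G (x +i* (pi *+ 2))) = (fun=> 0).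
    by apply/funext => x; rewrite /G /expC/= cos0 sin0 cos2pi sin2pi subrr.
  have -> : cseg a 0 (fun=> 0 : C) = 0.
    by rewrite /cseg /= Rintegral_cst//= mul0r.
  rewrite add0r => /eqP; rewrite mulf_eq0 => /orP[/eqP/(congr1 (@complex.Im R))/= h|].
    by exfalso; move/eqP: (oner_neq0 R); apply; exact: h.
  rewrite (@csegD _ 0 _ (fun y => G (0 +i* y)) (fun y => - G (a +i* y))); last 2 first.
  - exact: entire_ccont_ver.
  - by apply: ccontN; exact: entire_ccont_ver.
  have -> : cseg 0 (pi *+ 2) (fun y => - G (a +i* y)) = - cseg 0 (pi *+ 2) (fun y => G (a +i* y)).
    have := @csegD _ 0 (pi *+ 2) (fun y => G (a +i* y)) (fun y => - G (a +i* y))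
      (entire_ccont_ver a eG) (ccontN (entire_ccont_ver a eG)).
    under [X in cseg _ _ X]eq_fun do rewrite subrr.
    have -> : cseg 0 (pi *+ 2) (fun=> 0 : C) = 0.
      by rewrite /cseg /= Rintegral_cst//= mul0r.
    by move=> /esym/eqP; rewrite addr_eq0 => /eqP ->; rewrite opprK.
  by rewrite subr_eq0 => /eqP.
have near e : 0 < e ->
    normc (cseg 0 (pi *+ 2) (fun t => G (0 +i* t)) - (pi *+ 2)%:C * H 0) <=
    2 * e * (pi *+ 2).
  move=> e0; have [r r0 rP] := entire_cvg 0 eH e0.
  have z1 : 0 < normc z + 1 by rewrite ltr_wpDl.
  pose a := Num.min 0 (ln (r / 2 / (normc z + 1))).
  have ra : expR a * normc z < r.
    have : expR a <= r / 2 / (normc z + 1).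
      rewrite -[leRHS]lnK; last by rewrite posrE !divr_gt0.
      by rewrite ler_expR /a ge_min lexx orbT.
    rewrite ler_pdivlMr// mulrDr mulr1 => h.
    have : 0 < expR a by exact: expR_gt0.
    lra.
  rewrite (const a); last by rewrite /a ge_min lexx.
  have := @cseg_near _ 0 (pi *+ 2) (fun t => G (a +i* t)) (H 0) e pi2
     (entire_ccont_ver a eG); rewrite subr0; apply => x _.
  have := rP (expC (a +i* x) * z); rewrite add0r => h; apply/ltW/h.
  by rewrite normcM normc_expC.
apply/eqP; rewrite -subr_eq0; apply/eqP/normc_eq0/eqP.
rewrite eq_le normc_ge0 andbT; apply/ler_addgt0Pl => e e0; rewrite addr0.
have p0 : 0 < 2 * ((pi : R) *+ 2) by rewrite mulr_gt0// mulrn_wgt0// pi_gt0.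
have := near (e / (2 * (pi *+ 2))); rewrite divr_gt0// => /(_ isT).
by move=> /le_trans; apply; rewrite mulrAC mulrCA divff ?mulr1// gt_eqF.
Qed.

End circle_mean.

(** * Measurability of complex functions *)

Section complex_measurability.
Variable R : realType.
Local Notation C := R[i].

Lemma measurable_Re : measurable_fun setT (@complex.Re R).
Proof.
exact: (measurableT_comp measurable_fst (@measurable_plane_of_complex R)).
Qed.

Lemma measurable_Im : measurable_fun setT (@complex.Im R).
Proof.
exact: (measurableT_comp measurable_snd (@measurable_plane_of_complex R)).
Qed.

Context d (T : measurableType d).
Implicit Types f g : T -> C.

Lemma measurable_fun_Re f : measurable_fun setT f ->
  measurable_fun setT (fun x => complex.Re (f x)).
Proof. exact: (measurableT_comp measurable_Re). Qed.

Lemma measurable_fun_Im f : measurable_fun setT f ->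
  measurable_fun setT (fun x => complex.Im (f x)).
Proof. exact: (measurableT_comp measurable_Im). Qed.

Lemma measurable_fun_complex f :
  measurable_fun setT (fun x => complex.Re (f x)) ->
  measurable_fun setT (fun x => complex.Im (f x)) -> measurable_fun setT f.
Proof.
move=> mr mi; have := measurableT_comp (@measurable_complex_of_plane R)
  (measurable_fun_pair mr mi).
by congr (measurable_fun _ _); apply/funext => x /=; apply: complexP.
Qed.

Lemma measurable_fun_cD f g : measurable_fun setT f -> measurable_fun setT g ->
  measurable_fun setT (fun x => f x + g x).
Proof.
move=> mf mg; apply: measurable_fun_complex.
  under eq_fun do rewrite ReD.
  by apply: measurable_funD; exact: measurable_fun_Re.
under eq_fun do rewrite ImD.
by apply: measurable_funD; exact: measurable_fun_Im.
Qed.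

Lemma measurable_fun_cN f : measurable_fun setT f ->
  measurable_fun setT (fun x => - f x).
Proof.
move=> mf; apply: measurable_fun_complex.
  under eq_fun do rewrite ReN.
  by apply: measurable_funN; exact: measurable_fun_Re.
under eq_fun do rewrite ImN.
by apply: measurable_funN; exact: measurable_fun_Im.
Qed.

Lemma measurable_fun_cB f g : measurable_fun setT f -> measurable_fun setT g ->
  measurable_fun setT (fun x => f x - g x).
Proof. by move=> mf mg; apply: measurable_fun_cD => //; exact: measurable_fun_cN. Qed.

Lemma measurable_fun_cM f g : measurable_fun setT f -> measurable_fun setT g ->
  measurable_fun setT (fun x => f x * g x).
Proof.
move=> mf mg; apply: measurable_fun_complex.
  under eq_fun do rewrite ReM.
  by apply: measurable_funB; apply: measurable_funM;
    (exact: measurable_fun_Re || exact: measurable_fun_Im).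
under eq_fun do rewrite ImM.
by apply: measurable_funD; apply: measurable_funM;
  (exact: measurable_fun_Re || exact: measurable_fun_Im).
Qed.

Lemma measurable_fun_conj f : measurable_fun setT f ->
  measurable_fun setT (fun x => (f x)^*).
Proof.
move=> mf; apply: measurable_fun_complex.
  by under eq_fun do rewrite Re_conj; exact: measurable_fun_Re.
by under eq_fun do rewrite Im_conj; apply: measurable_funN; exact: measurable_fun_Im.
Qed.

Lemma measurable_fun_real (u : T -> R) : measurable_fun setT u ->
  measurable_fun setT (fun x => (u x)%:C).
Proof.
by move=> mu; apply: measurable_fun_complex => //=; exact: measurable_cst.
Qed.

Lemma measurable_fun_normc f : measurable_fun setT f ->
  measurable_fun setT (fun x => normc (f x)).
Proof.
move=> mf; have -> : (fun x => normc (f x)) = (fun x => Num.sqrt (normc (f x) ^+ 2)).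
  by apply/funext => x; rewrite sqrtr_sqr ger0_norm.
apply: measurableT_comp; last exact: measurable_sqr_normc.
by apply: continuous_measurable_fun; exact: sqrt_continuous.
Qed.

Lemma measurable_fun_expC f : measurable_fun setT f ->
  measurable_fun setT (fun x => expC (f x)).
Proof.
move=> mf; apply: measurable_fun_cM.
  apply: measurable_fun_real; apply: measurableT_comp => //.
  exact: measurable_fun_Re.
apply: measurable_fun_complex => /=.
  apply: (measurableT_comp (f := cos)); last exact: measurable_fun_Im.
  by apply: continuous_measurable_fun; exact: continuous_cos.
apply: (measurableT_comp (f := sin)); last exact: measurable_fun_Im.
by apply: continuous_measurable_fun; exact: continuous_sin.
Qed.

End complex_measurability.

Section entire_measurability.
Variable R : realType.
Local Notation C := R[i].

(** An open set of the plane is a countable union of squares with rational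
    centres and sides. *)
Lemma measurable_fun_continuous_plane (u : C -> R) :
  (forall z e, 0 < e -> exists2 r : R, 0 < r &
     forall w, normc w < r -> `|u (z + w) - u z| < e) ->
  measurable_fun setT u.
Proof.
move=> cu; apply: (measurability _ (RGenOInfty.measurableE R)) => //.
move=> _ [_ [x ->] <-]; rewrite setTI.
pose B (p q s : rat) : set C := [set z | `|complex.Re z - ratr p| < ratr s /\
   `|complex.Im z - ratr q| < ratr s].
have mB p q s : measurable (B p q s).
  have mS (a : rat) : measurable [set x : R | `|x - ratr a| < ratr s].
    rewrite (_ : mkset _ = ball (ratr a : R) (ratr s)); first exact: measurable_ball.
    by apply/seteqP; split=> t; rewrite /ball /= distrC.
  apply: measurableI; rewrite -[X in measurable X]setTI.
    exact: (measurable_Re measurableT (mS p)).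
  exact: (measurable_Im measurableT (mS q)).
pose U := u @^-1` `]x, +oo[.
have -> : u @^-1` `]x, +oo[ = \bigcup_p \bigcup_q \bigcup_s
    (if `[< B p q s `<=` U >] then B p q s else set0).
  apply/seteqP; split=> z; last first.
    by move=> [p _ [q _ [s _]]]; case: ifPn => // /asboolP BU /BU.
  rewrite /= in_itv/= andbT => xz.
  have [r r0 rP] := cu z (u z - x) (ltac:(by rewrite subr_gt0)).
  have [s /[!in_itv]/= /andP[s0 sr]] := @rat_in_itvoo R 0 (r / 4) (ltac:(by rewrite divr_gt0)).
  have near (t : R) : exists p : rat, `|t - ratr p| < ratr s.
    have [p /[!in_itv]/= /andP[p1 p2]] := @rat_in_itvoo R (t - ratr s) (t + ratr s) (ltac:(lra)).
    by exists p; rewrite ltr_norml; apply/andP; split; lra.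
  have [p zp] := near (complex.Re z); have [q zq] := near (complex.Im z).
  exists p => //; exists q => //; exists s => //.
  rewrite ifT; first by split.
  apply/asboolP => w [wp wq]; rewrite /U /= in_itv/= andbT.
  have := rP (w - z); rewrite subrKC => h.
  suff : `|u w - u z| < u z - x by rewrite ltr_norml => /andP[]; lra.
  apply: h; apply: (le_lt_trans (ler_normc_ReIm _)); rewrite !(ReD,ReN,ImD,ImN).
  move: wp wq zp zq; rewrite !ltr_norml => /andP[? ?] /andP[? ?] /andP[? ?] /andP[? ?].
  have h1 : `|complex.Re w - complex.Re z| < r / 2.
    by rewrite ltr_norml; apply/andP; split; lra.
  have h2 : `|complex.Im w - complex.Im z| < r / 2.
    by rewrite ltr_norml; apply/andP; split; lra.
  lra.
apply: bigcupT_measurable_rat => p; apply: bigcupT_measurable_rat => q.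
by apply: bigcupT_measurable_rat => s; case: ifPn.
Qed.

Lemma measurable_entire (f : C -> C) : entire f -> measurable_fun setT f.
Proof.
move=> ef; apply: measurable_fun_complex; apply: measurable_fun_continuous_plane => z e e0.
  have [r r0 rP] := entire_cvg z ef e0; exists r => // w /rP; apply: le_lt_trans.
  by rewrite -ReN -ReD ler_Re_normc.
have [r r0 rP] := entire_cvg z ef e0; exists r => // w /rP; apply: le_lt_trans.
by rewrite -ImN -ImD ler_Im_normc.
Qed.

End entire_measurability.

(** * Densities, and shears of the plane *)

Section density.
Context d (T : measurableType d) (R : realType).
Variables (m : {measure set T -> \bar R}) (w : T -> R).
Hypotheses (mw : measurable_fun setT w) (w0 : forall x, 0 <= w x).
Local Notation dm := (density_measure m mw w0).
Import HBNNSimple.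
Local Open Scope ereal_scope.

Let ge0_integral_density (f : T -> \bar R) :
  measurable_fun setT f -> (forall x, 0 <= f x) ->
  \int[dm]_x f x = \int[m]_x (f x * (w x)%:E).
Proof.
move=> mf f0; pose h := nnsfun_approx measurableT mf.
have mwE : measurable_fun setT (fun x => (w x)%:E) by exact/measurable_EFinP.
have hn n x : 0 <= (h n x)%:E by rewrite lee_fin.
have cvgh x : (h n x)%:E @[n --> \oo] --> f x by exact: cvg_nnsfun_approx.
have ndh x : {homo (fun n => (h n x)%:E) : a b / (a <= b)%N >-> a <= b}.
  by move=> a b ab; rewrite lee_fin; exact/lefP/nd_nnsfun_approx.
have mh n : measurable_fun setT (fun x => (h n x)%:E) by exact/measurable_EFinP.
transitivity (limn (fun n => \int[dm]_x (h n x)%:E)).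
  rewrite -monotone_convergence//.
  by apply: eq_integral => x _; apply/esym/cvg_lim.
transitivity (limn (fun n => \int[m]_x ((h n x)%:E * (w x)%:E))); last first.
  rewrite -monotone_convergence//.
  - apply: eq_integral => x _; apply/cvg_lim => //.
    by apply: cvgeZr => //; exact: cvgh.
  - by move=> n; exact: emeasurable_funM.
  - by move=> n x _; rewrite mule_ge0// lee_fin.
  - by move=> x _ a b ab; rewrite lee_wpmul2r ?lee_fin ?w0//; exact: ndh.
congr (limn _); apply/funext => n.
transitivity (\int[dm]_x (\sum_(y \in range (h n)) (y * \1_(h n @^-1` [set y]) x)%:E)).
  by apply: eq_integral => x _; rewrite fimfunE -fsumEFin.
have mi r : measurable_fun setT (fun x => (r * \1_(h n @^-1` [set r]) x)%:E).
  by apply/measurable_EFinP; exact: measurable_funM.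
rewrite ge0_integral_fsum//; last by move=> r x _; exact: nnfun_muleindic_ge0.
transitivity (\int[m]_x (\sum_(y \in range (h n))
    ((y * \1_(h n @^-1` [set y]) x)%:E * (w x)%:E))); last first.
  apply: eq_integral => x _.
  rewrite -ge0_mule_fsuml; last by move=> r; exact: nnfun_muleindic_ge0.
  by rewrite fsumEFin// -(fimfunE (h n) x).
rewrite ge0_integral_fsum//; last 2 first.
- by move=> r; exact: emeasurable_funM.
- by move=> r x _; apply: mule_ge0; [exact: nnfun_muleindic_ge0|rewrite lee_fin].
apply: eq_fsbigr => r /[!inE] -[t _ <-].
have mr : measurable (h n @^-1` [set h n t]) by exact: measurable_sfunP.
under eq_integral do rewrite EFinM.
rewrite ge0_integralZl//; last first.
  by apply/measurable_EFinP.
rewrite integral_indic// setIT.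
under [RHS]eq_integral do rewrite EFinM -muleA.
rewrite ge0_integralZl//; last 2 first.
- by apply: emeasurable_funM => //; apply/measurable_EFinP.
- by move=> x _; rewrite mule_ge0 ?lee_fin.
congr (_ * _); rewrite [LHS]integral_mkcond.
by apply: eq_integral => x _; rewrite epatch_indic muleC.
Qed.

(** Integration against a density, with no integrability assumption: both
    sides are differences of the integrals of positive and negative parts. *)
Lemma integral_density (D : set T) (f : T -> \bar R) : measurable D ->
  measurable_fun D f ->
  \int[dm]_(x in D) f x = \int[m]_(x in D) (f x * (w x)%:E).
Proof.
move=> mD mf; rewrite [LHS]integral_mkcond [RHS]integral_mkcond.
have -> : (fun x => f x * (w x)%:E) \_ D = fun x => (f \_ D) x * (w x)%:E.
  by apply/funext => x; rewrite /patch; case: ifPn => //; rewrite mul0e.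
move: mf => /(measurable_restrictT _ mD); move: (f \_ D) => {mD}f mf.
rewrite [LHS]integralE [RHS]integralE; congr (_ - _).
  rewrite ge0_integral_density//; last exact: measurable_funepos.
  apply: eq_integral => x _; by rewrite !funeposE maxe_pMl ?mul0e ?lee_fin.
rewrite ge0_integral_density//; last exact: measurable_funeneg.
by apply: eq_integral => x _; rewrite !funenegE -mulNe maxe_pMl ?mul0e ?lee_fin.
Qed.

End density.

Section lebesgue_invariance.
Variable R : realType.
Local Notation C := R[i].
Local Notation lambda := (@lebesgue_measure R).
Local Notation lambda2 := (lambda \x lambda)%E.

Lemma lebesgue_translation (a : R) (A : set R) : measurable A ->
  lambda ((fun x : R => x + a) @^-1` A) = lambda A.
Proof.
have ma : measurable_fun setT (fun x : measurableTypeR R => x + a : measurableTypeR R).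
  exact: measurable_funD.
pose m' : {measure set (measurableTypeR R) -> \bar R} :=
  pushforward lambda (fun x : measurableTypeR R => x + a : measurableTypeR R).
move=> mA; apply/esym.
suff : forall X, ocitv X -> lambda X = m' ma X.
  by move=> /lebesgue_measure_unique; apply.
move=> _ [[p q]] _ <-; rewrite /m' /= /pushforward /=.
have -> : (fun x => x + a) @^-1` `]p, q] = `]p - a, q - a]%classic.
  by apply/seteqP; split=> x /=; rewrite !in_itv/= lerBrDr ltrBlDr.
by rewrite !lebesgue_measure_itv/= !lte_fin ltrD2r -!EFinB opprB addrA subrK.
Qed.

(** A vertical shear translates each vertical section. *)
Lemma shear_ver (psi : R -> R) (A : set (R * R)) : measurable_fun setT psi ->
  measurable A ->
  lambda2 ((fun p : R * R => (p.1, p.2 + psi p.1)) @^-1` A) = lambda2 A.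
Proof.
move=> mpsi mA; rewrite /product_measure1; apply: eq_integral => x _ /=.
rewrite -[RHS](lebesgue_translation (psi x)); last exact: measurable_xsection.
congr (lambda _); by apply/seteqP; split=> y; rewrite /xsection/= !inE.
Qed.

Lemma lambda2_swap (A : set (R * R)) : measurable A ->
  lambda2 A = (lambda \x^ lambda)%E A.
Proof.
move=> mA; apply: product_measure_unique => // B D mB mD.
exact: product_measure2E.
Qed.

Lemma shear_hor (psi : R -> R) (A : set (R * R)) : measurable_fun setT psi ->
  measurable A ->
  lambda2 ((fun p : R * R => (p.1 + psi p.2, p.2)) @^-1` A) = lambda2 A.
Proof.
move=> mpsi mA; rewrite !lambda2_swap//; last first.
  rewrite -[X in measurable X]setTI; apply: measurable_fun_pair => //.
  apply: measurable_funD => //; exact: measurableT_comp.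
rewrite /product_measure2; apply: eq_integral => y _ /=.
rewrite -[RHS](lebesgue_translation (psi y)); last exact: measurable_ysection.
congr (lambda _); by apply/seteqP; split=> x; rewrite /ysection/= !inE.
Qed.

End lebesgue_invariance.

(** * Rotations, translations and Gaussian integrals *)

Section planar_invariance.
Variable R : realType.
Local Notation C := R[i].
Local Notation lambda := (@lebesgue_measure R).
Local Notation lambda2 := (lambda \x lambda)%E.

Lemma planar_lebesgueE (A : set C) :
  planar_lebesgue A = lambda2 (@complex_of_plane R @^-1` A).
Proof. by []. Qed.

Lemma measurable_preimage d d' (T : measurableType d) (T' : measurableType d')
  (f : T -> T') (A : set T') :
  measurable_fun setT f -> measurable A -> measurable (f @^-1` A).
Proof. by move=> mf mA; rewrite -[X in measurable X]setTI; exact: mf. Qed.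

Let mplane (A : set C) : measurable A -> measurable (@complex_of_plane R @^-1` A).
Proof.
by move=> mA; apply: measurable_preimage mA; exact: measurable_complex_of_plane.
Qed.

Lemma planar_translation (a : C) (A : set C) : measurable A ->
  planar_lebesgue ((fun z => z + a) @^-1` A) = planar_lebesgue A.
Proof.
move=> mA; rewrite !planar_lebesgueE.
rewrite -(@shear_ver R (fun=> complex.Im a) (@complex_of_plane R @^-1` A)) //;
  last exact: mplane.
rewrite -[RHS](@shear_hor R (fun=> complex.Re a))//.
  congr (lambda2 _); apply/seteqP.
  by split=> -[x y] /=; rewrite /complex_of_plane /=; case: (a).
apply: measurable_preimage (mplane mA); apply: measurable_fun_pair => //.
exact: measurable_funD.
Qed.

(** A rotation other than [-1] is a product of three shears. *)
Let planar_rotation_neqN1 (u : C) (A : set C) : normc u = 1 ->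
  complex.Re u != -1 -> measurable A ->
  planar_lebesgue ((fun z => u * z) @^-1` A) = planar_lebesgue A.
Proof.
case: u => c s /= u1 c1 mA; rewrite !planar_lebesgueE.
have cs : c ^+ 2 + s ^+ 2 = 1.
  by have := sqr_normcE (c +i* s); rewrite u1 expr1n.
have c10 : 1 + c != 0 by rewrite addrC addr_eq0.
set t := s / (1 + c).
have st : 1 - s * t = c.
  have ss : s * s = (1 - c) * (1 + c) by have := cs; rewrite !expr2; lra.
  by rewrite /t mulrA ss mulfK//; ring.
pose S1 (p : R * R) := (p.1 - t * p.2, p.2).
pose S2 (p : R * R) := (p.1, p.2 + s * p.1).
have mt k : measurable_fun setT (fun x : R => k * x) by exact: measurable_funM.
have mS1 : measurable_fun setT S1.
  apply: measurable_fun_pair => //; apply: measurable_funB => //.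
  exact: measurable_funM.
have mS2 : measurable_fun setT S2.
  apply: measurable_fun_pair => //; apply: measurable_funD => //.
  exact: measurable_funM.
have h1 B : measurable B -> lambda2 (S1 @^-1` B) = lambda2 B.
  move=> mB; rewrite -[RHS](@shear_hor R (fun x => - t * x))//.
  by congr (lambda2 _); apply/seteqP; split=> -[x y] /=; rewrite /S1/= mulNr.
have h2 B : measurable B -> lambda2 (S2 @^-1` B) = lambda2 B.
  by move=> mB; rewrite -[RHS](@shear_ver R (fun x => s * x)).
have mA' := mplane mA.
rewrite -[RHS]h1// -[RHS]h2; last exact: measurable_preimage.
rewrite -[RHS]h1; last by do 2 apply: measurable_preimage => //.
congr (lambda2 _); apply/funext => -[x y]; rewrite /S1 /S2 /preimage /=.
congr (A _); rewrite /complex_of_plane /=.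
have E1 : y + s * (x - t * y) = s * x + c * y.
  by rewrite -[in RHS]st; ring.
have E2 : x - t * y - t * (s * x + c * y) = c * x - s * y.
  have -> : x - t * y - t * (s * x + c * y) = (1 - s * t) * x - t * (1 + c) * y by ring.
  by rewrite st /t divfK.
rewrite E1 E2; apply: complexP; rewrite ?(ReM, ImM) //=.
exact: addrC.
Qed.

Lemma planar_rotation (u : C) (A : set C) : normc u = 1 -> measurable A ->
  planar_lebesgue ((fun z => u * z) @^-1` A) = planar_lebesgue A.
Proof.
move=> u1 mA; have [uN1|] := eqVneq (complex.Re u) (-1); last first.
  by move=> ?; exact: planar_rotation_neqN1.
have i1 : normc ('i%C : C) = 1.
  by rewrite /ComplexField.Normc.normc expr0n expr1n add0r sqrtr1.
have i0 : complex.Re ('i%C : C) != -1 by rewrite /= eq_sym oppr_eq0 oner_eq0.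
have -> : u = 'i%C * 'i%C.
  apply: complexP; rewrite ?(ReM, ImM) /= ?uN1; first by ring.
  have := sqr_normcE u; rewrite u1 uN1 expr1n sqrrN expr1n => h.
  have /eqP : complex.Im u ^+ 2 = 0 by apply: (addrI 1); rewrite -h addr0.
  by rewrite sqrf_eq0 => /eqP ->; ring.
rewrite -[RHS](planar_rotation_neqN1 i1 i0 mA).
rewrite -[RHS](planar_rotation_neqN1 i1 i0); last first.
  apply: measurable_preimage mA.
  by apply: measurable_fun_cM => //.
by congr planar_lebesgue; apply/funext => z; rewrite /preimage /= mulrA.
Qed.
End planar_invariance.

Section gaussian_integral.
Variable R : realType.
Local Notation C := R[i].
Local Notation lambda := (@lebesgue_measure R).
Local Notation lambda2 := (lambda \x lambda)%E.

Lemma integral_gauss_line (c b : R) : 0 < c ->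
  (\int[lambda]_x (expR (2 * (b * x) - c * x ^+ 2))%:E =
   (Num.sqrt (pi / c) * expR (b ^+ 2 / c))%:E)%E.
Proof.
move=> c0; pose s := Num.sqrt ((2 * c)^-1).
have c2 : 0 < (2 * c)^-1 by rewrite invr_gt0 mulr_gt0.
have s0 : s != 0 by rewrite gt_eqF// sqrtr_gt0.
have s2 : s ^+ 2 = (2 * c)^-1 by rewrite sqr_sqrtr// ltW.
have := integral_normal_pdf (b / c) s.
have peak0 : normal_peak s != 0 by rewrite gt_eqF// normal_peak_gt0.
have peakE : normal_peak s = (Num.sqrt (pi / c))^-1.
  rewrite /normal_peak s2; congr (Num.sqrt _)^-1.
  by field; rewrite gt_eqF.
have E x : expR (2 * (b * x) - c * x ^+ 2) =
    (Num.sqrt (pi / c) * expR (b ^+ 2 / c)) * normal_pdf (b / c) s x.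
  rewrite normal_pdfE// peakE /normal_fun s2 mulrACA divff; last first.
    by rewrite gt_eqF// sqrtr_gt0 divr_gt0// pi_gt0.
  by rewrite mul1r -expRD; congr expR; field; rewrite gt_eqF.
under [X in _ -> X = _]eq_integral do rewrite E EFinM.
move=> H; rewrite ge0_integralZl//.
- by rewrite H mule1.
- by apply/measurable_EFinP; exact: measurable_normal_pdf.
- by move=> x _; rewrite lee_fin normal_pdf_ge0.
Qed.

Local Open Scope ereal_scope.

Lemma ge0_integral_planar (f : C -> \bar R) : measurable_fun setT f ->
  (forall z, 0 <= f z) ->
  \int[planar_lebesgue]_z f z = \int[lambda]_x \int[lambda]_y f (Complex x y).
Proof.
move=> mf f0; rewrite ge0_integral_pushforward//; last exact: measurable_complex_of_plane.
rewrite preimage_setT fubini_tonelli1//; last by move=> p; exact: f0.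
by apply: measurableT_comp => //; exact: measurable_complex_of_plane.
Qed.

(** The Gaussian integral with linear and quadratic terms in the exponent. *)
Lemma integral_gauss_exp (s : R) (z : C) : (0 < 1 + s)%R ->
  \int[gauss]_a (expR (2 * complex.Re (z * a^*) - s * normc a ^+ 2))%:E =
  ((1 + s)^-1 * expR (normc z ^+ 2 / (1 + s)))%:E.
Proof.
move=> s0.
have mf : measurable_fun setT
    (fun a : C => (expR (2 * complex.Re (z * a^*) - s * normc a ^+ 2))%:E).
  apply/measurable_EFinP; apply: measurableT_comp => //; apply: measurable_funB.
    apply: measurable_funM => //; apply: measurable_fun_Re.
    by apply: measurable_fun_cM => //; exact: measurable_fun_conj.
  by apply: measurable_funM => //; exact: measurable_sqr_normc.
rewrite integral_density// ge0_integral_planar; last 2 first.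
- apply: emeasurable_funM => //; apply/measurable_EFinP; exact: measurable_gauss_weight.
- by move=> a; rewrite mule_ge0// lee_fin ?expR_ge0// gauss_weight_ge0.
case: z {mf} => p q.
transitivity (\int[lambda]_x \int[lambda]_y
   (((pi^-1)%:E * (expR (2 * (p * x) - (1 + s) * x ^+ 2))%:E) *
    (expR (2 * (q * y) - (1 + s) * y ^+ 2))%:E)).
  apply: eq_integral => x _; apply: eq_integral => y _.
  rewrite /gauss_weight -!EFinM mulrCA -mulrA -!expRD sqr_normcE ReM /=.
  by congr ((_ * expR _)%:E); ring.
have me k : measurable_fun setT (fun x : R => (expR (2 * (k * x) - (1 + s) * x ^+ 2))%:E).
  apply/measurable_EFinP; apply: measurableT_comp => //; apply: measurable_funB.
    by do 2 apply: measurable_funM => //.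
  by apply: measurable_funM => //; exact: measurable_funX.
have inner (k : \bar R) : 0 <= k ->
    \int[lambda]_y (k * (expR (2 * (q * y) - (1 + s) * y ^+ 2))%:E) =
    k * (Num.sqrt (pi / (1 + s)) * expR (q ^+ 2 / (1 + s)))%:E.
  move=> k0; rewrite ge0_integralZl// ?integral_gauss_line//.
  exact: me.
transitivity (\int[lambda]_x (((pi^-1)%:E * (expR (2 * (p * x) - (1 + s) * x ^+ 2))%:E) *
    (Num.sqrt (pi / (1 + s)) * expR (q ^+ 2 / (1 + s)))%:E)).
  apply: eq_integral => x _; rewrite inner// mule_ge0// lee_fin ?expR_ge0//.
  by rewrite invr_ge0 pi_ge0.
have pV0 : 0 <= ((pi : R)^-1)%:E by rewrite lee_fin invr_ge0 pi_ge0.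
have e0 (k x : R) : 0 <= (expR (2 * (k * x) - (1 + s) * x ^+ 2))%:E.
  by rewrite lee_fin expR_ge0.
have mk (k : R) : measurable_fun setT
    (fun x : R => (pi^-1)%:E * (expR (2 * (k * x) - (1 + s) * x ^+ 2))%:E).
  by apply: emeasurable_funM; [exact: measurable_cst|exact: me].
rewrite ge0_integralZr//; try by [move=> x _; exact: mule_ge0|exact: mk].
rewrite ge0_integralZl//; last exact: me.
rewrite integral_gauss_line// -!EFinM; congr EFin.
have sq : (Num.sqrt (pi / (1 + s)) * Num.sqrt (pi / (1 + s)) = pi / (1 + s) :> R)%R.
  by rewrite -expr2 sqr_sqrtr// divr_ge0 ?pi_ge0// ltW.
have -> : (normc (p +i* q) ^+ 2 / (1 + s) = p ^+ 2 / (1 + s) + q ^+ 2 / (1 + s))%R.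
  by rewrite sqr_normcE /= mulrDl.
rewrite expRD; set E1 := expR _; set E2 := expR _.
transitivity (pi^-1 * (Num.sqrt (pi / (1 + s)) * Num.sqrt (pi / (1 + s))) * (E1 * E2))%R.
  by ring.
by rewrite sq mulKf// gt_eqF// pi_gt0.
Qed.

End gaussian_integral.

(** * Integrals of complex functions *)

Lemma ReZ (R : realType) (k : R) (z : R[i]) :
  complex.Re (k%:C * z) = k * complex.Re z.
Proof. by rewrite ReM /= mul0r subr0. Qed.

Lemma ImZ (R : realType) (k : R) (z : R[i]) :
  complex.Im (k%:C * z) = k * complex.Im z.
Proof. by rewrite ImM /= mul0r addr0. Qed.

Section cauchy_schwarz.
Context d (T : measurableType d) (R : realType) (m : {measure set T -> \bar R}).
Local Open Scope ereal_scope.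

Lemma ge0_cauchy_schwarz (a b : T -> R) (M N : R) :
  measurable_fun setT a -> measurable_fun setT b ->
  (forall x, 0 <= a x)%R -> (forall x, 0 <= b x)%R ->
  (0 <= M)%R -> (0 <= N)%R ->
  \int[m]_x (a x ^+ 2)%:E <= M%:E -> \int[m]_x (b x ^+ 2)%:E <= N%:E ->
  \int[m]_x (a x * b x)%:E <= (Num.sqrt M * Num.sqrt N)%:E.
Proof.
move=> ma mb a0 b0 M0 N0 aM bN.
have N2 (f : T -> R) K : (forall x, 0 <= f x)%R -> (0 <= K)%R ->
    \int[m]_x (f x ^+ 2)%:E <= K%:E -> Lnorm m 2%:E (EFin \o f) <= (Num.sqrt K)%:E.
  move=> f0 K0 fK; rewrite unlock.
  under eq_integral do rewrite /= ger0_norm// powR_mulrn//.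
  rewrite -powR12_sqrt// -poweR_EFin.
  apply: gt0_ler_poweR => //; rewrite in_itv/= leey andbT ?lee_fin//.
  by apply: integral_ge0 => x _; rewrite lee_fin sqr_ge0.
have := hoelder m ma mb (p := 2) (q := 2).
rewrite !ltr0n => /(_ isT isT); rewrite -div1r -splitr => /(_ erefl) h.
have -> : \int[m]_x (a x * b x)%:E = Lnorm m 1 (EFin \o (a \* b)%R).
  rewrite Lnorm1; apply: eq_integral => x _.
  by rewrite /= ger0_norm// mulr_ge0.
apply: (le_trans h); rewrite EFinM.
by apply: lee_pmul; rewrite ?Lnorm_ge0//; exact: N2.
Qed.

End cauchy_schwarz.

Section complex_integration.
Context d (T : measurableType d) (R : realType).
Local Notation C := R[i].
Implicit Types (m : {measure set T -> \bar R}) (f g : T -> C).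

(** The integral of a complex function on any measured space, and the
    corresponding notion of integrability. *)
Definition cint m f : C :=
  (\int[m]_x complex.Re (f x)) +i* (\int[m]_x complex.Im (f x)).

Definition cintegrable m f : Prop :=
  measurable_fun setT f /\ (\int[m]_x (normc (f x))%:E < +oo)%E.

Lemma ge0_le_integralT m (u v : T -> R) : measurable_fun setT u ->
  measurable_fun setT v -> (forall x, 0 <= u x <= v x) ->
  (\int[m]_x (u x)%:E <= \int[m]_x (v x)%:E)%E.
Proof.
move=> mu mv uv; apply: ge0_le_integral => //; try exact/measurable_EFinP.
- by move=> x _; rewrite lee_fin; case/andP: (uv x).
- by move=> x _; rewrite lee_fin; case/andP: (uv x).
Qed.

Lemma cintegrable_Re m f : cintegrable m f ->
  m.-integrable setT (EFin \o (fun x => complex.Re (f x))).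
Proof.
move=> [mf fi]; apply/integrableP; split.
  by apply/measurable_EFinP; exact: measurable_fun_Re.
apply: le_lt_trans fi; apply: ge0_le_integralT => /=.
- by apply: measurableT_comp => //; exact: measurable_fun_Re.
- exact: measurable_fun_normc.
- by move=> x; rewrite normr_ge0 ler_Re_normc.
Qed.

Lemma cintegrable_Im m f : cintegrable m f ->
  m.-integrable setT (EFin \o (fun x => complex.Im (f x))).
Proof.
move=> [mf fi]; apply/integrableP; split.
  by apply/measurable_EFinP; exact: measurable_fun_Im.
apply: le_lt_trans fi; apply: ge0_le_integralT => /=.
- by apply: measurableT_comp => //; exact: measurable_fun_Im.
- exact: measurable_fun_normc.
- by move=> x; rewrite normr_ge0 ler_Im_normc.
Qed.

Lemma cintegrable_le m f (u : T -> R) : measurable_fun setT f ->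
  measurable_fun setT u -> (forall x, normc (f x) <= u x) ->
  (\int[m]_x (u x)%:E < +oo)%E -> cintegrable m f.
Proof.
move=> mf mu fu ui; split => //; apply: le_lt_trans ui.
apply: ge0_le_integralT => //; first exact: measurable_fun_normc.
by move=> x; rewrite normc_ge0 fu.
Qed.

Lemma cintegrableD m f g : cintegrable m f -> cintegrable m g ->
  cintegrable m (fun x => f x + g x).
Proof.
move=> [mf fi] [mg gi].
apply: (@cintegrable_le _ _ (fun x => normc (f x) + normc (g x))).
- exact: measurable_fun_cD.
- by apply: measurable_funD; exact: measurable_fun_normc.
- by move=> x; exact: normcD.
under eq_integral do rewrite EFinD.
rewrite ge0_integralD//; try (apply/measurable_EFinP; exact: measurable_fun_normc);
  try (by move=> x _; rewrite lee_fin).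
exact: lte_add_pinfty.
Qed.

Lemma cintegrableZ m (c : C) f : cintegrable m f ->
  cintegrable m (fun x => c * f x).
Proof.
move=> [mf fi]; apply: (@cintegrable_le _ _ (fun x => normc c * normc (f x))).
- by apply: measurable_fun_cM => //; exact: measurable_cst.
- by apply: measurable_funM => //; exact: measurable_fun_normc.
- by move=> x; rewrite normcM.
under eq_integral do rewrite EFinM.
rewrite ge0_integralZl//; try (by move=> x _; rewrite lee_fin).
- by rewrite lte_mul_pinfty// lee_fin.
- by apply/measurable_EFinP; exact: measurable_fun_normc.
- by rewrite lee_fin.
Qed.

Lemma cintD m f g : cintegrable m f -> cintegrable m g ->
  cint m (fun x => f x + g x) = cint m f + cint m g.
Proof.
move=> fi gi; apply: complexP; rewrite ?(ReD, ImD) /=.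
  rewrite -RintegralD//; try exact: cintegrable_Re.
  by apply: eq_Rintegral => x _; rewrite ReD.
rewrite -RintegralD//; try exact: cintegrable_Im.
by apply: eq_Rintegral => x _; rewrite ImD.
Qed.

Lemma cintZ m (c : C) f : cintegrable m f ->
  cint m (fun x => c * f x) = c * cint m f.
Proof.
move=> fi.
have iR k : m.-integrable setT (EFin \o (fun x => k * complex.Re (f x))).
  by have := integrableZl measurableT k (cintegrable_Re fi); apply: eq_integrable.
have iI k : m.-integrable setT (EFin \o (fun x => k * complex.Im (f x))).
  by have := integrableZl measurableT k (cintegrable_Im fi); apply: eq_integrable.
apply: complexP; rewrite ?(ReM, ImM) /=.
  rewrite -!RintegralZl//; try exact: cintegrable_Re; try exact: cintegrable_Im.
  rewrite -RintegralB//; first by apply: eq_Rintegral => x _; rewrite ReM.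
rewrite -!RintegralZl//; try exact: cintegrable_Re; try exact: cintegrable_Im.
rewrite -RintegralD//; first by apply: eq_Rintegral => x _; rewrite ImM.
Qed.

Lemma eq_cint m f g : (forall x, f x = g x) -> cint m f = cint m g.
Proof. by move=> fg; congr (cint m _); apply/funext. Qed.

Lemma cint_conj m f : cintegrable m f -> (cint m f)^* = cint m (fun x => (f x)^*).
Proof.
move=> fi; apply: complexP; rewrite ?(Re_conj, Im_conj) /=.
  by apply: eq_Rintegral => x _; rewrite Re_conj.
rewrite -mulN1r -RintegralZl//; last exact: cintegrable_Im.
by apply: eq_Rintegral => x _; rewrite Im_conj mulN1r.
Qed.

(** The triangle inequality: a rotation makes the integral real. *)
Lemma le_normc_cint m f : cintegrable m f ->
  ((normc (cint m f))%:E <= \int[m]_x (normc (f x))%:E)%E.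
Proof.
move=> fi; set I := cint m f; have [I0|I0] := eqVneq I 0.
  by rewrite I0 normc_zero integral_ge0// => x _; rewrite lee_fin.
have nI : normc I != 0 by apply: contra_neq I0 => /normc_eq0.
pose u : C := ((normc I)^-1)%:C * I^*.
have u1 : normc u = 1.
  by rewrite normcM normc_real normc_conj ger0_norm ?invr_ge0// mulVf.
have uI : normc I = complex.Re (cint m (fun x => u * f x)).
  rewrite cintZ// -/I /u -mulrA ReZ ReM Re_conj Im_conj mulNr opprK.
  by rewrite -!expr2 -sqr_normcE expr2 mulKf.
have ufi := cintegrableZ u fi.
rewrite uI /=; apply: (@le_trans _ _ (`|\int[m]_x complex.Re (u * f x)|)%:E).
  by rewrite lee_fin ler_norm.
rewrite EFin_normr_Rintegral//; last exact: cintegrable_Re.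
apply: (le_trans (le_abse_integral m measurableT _)).
  by case/integrableP: (cintegrable_Re ufi).
apply: ge0_le_integralT => /=.
- apply: measurableT_comp => //; apply: measurable_fun_Re; exact: ufi.1.
- by apply: measurable_fun_normc; exact: fi.1.
- by move=> x; rewrite normr_ge0/= (le_trans (ler_Re_normc _))// normcM u1 mul1r.
Qed.

End complex_integration.

Section complex_fubini.
Context d1 d2 (T1 : measurableType d1) (T2 : measurableType d2) (R : realType).
Variables (m1 : {sigma_finite_measure set T1 -> \bar R}).
Variables (m2 : {sigma_finite_measure set T2 -> \bar R}).
Local Notation C := R[i].

Let Rfubini (u : T1 * T2 -> R) : measurable_fun setT u ->
  (\int[m1]_x \int[m2]_y `|u (x, y)|%:E < +oo)%E ->
  (forall x, m2.-integrable setT (EFin \o (fun y => u (x, y)))) ->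
  (forall y, m1.-integrable setT (EFin \o (fun x => u (x, y)))) ->
  \int[m1]_x \int[m2]_y u (x, y) = \int[m2]_y \int[m1]_x u (x, y).
Proof.
move=> mu ui i2 i1.
have mE : measurable_fun setT (EFin \o u) by exact/measurable_EFinP.
have : (m1 \x m2)%E.-integrable setT (EFin \o u) by exact/integrable12ltyP.
move=> /Fubini E; rewrite /Rintegral.
have E1 x : ((fine (\int[m2]_y (u (x, y))%:E))%:E = \int[m2]_y (u (x, y))%:E)%E.
  by rewrite fineK//; exact: (integrable_fin_num measurableT (i2 x)).
have E2 y : ((fine (\int[m1]_x (u (x, y))%:E))%:E = \int[m1]_x (u (x, y))%:E)%E.
  by rewrite fineK//; exact: (integrable_fin_num measurableT (i1 y)).
under eq_integral do rewrite E1.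
under [X in _ = fine X]eq_integral do rewrite E2.
by congr fine.
Qed.

Lemma cint_fubini (f : T1 * T2 -> C) : measurable_fun setT f ->
  (\int[m1]_x \int[m2]_y (normc (f (x, y)))%:E < +oo)%E ->
  (forall x, cintegrable m2 (fun y => f (x, y))) ->
  (forall y, cintegrable m1 (fun x => f (x, y))) ->
  cint m1 (fun x => cint m2 (fun y => f (x, y))) =
  cint m2 (fun y => cint m1 (fun x => f (x, y))).
Proof.
move=> mf fi i2 i1.
have le (u : T1 * T2 -> R) : measurable_fun setT u ->
    (forall p, `|u p| <= normc (f p)) ->
    (\int[m1]_x \int[m2]_y `|u (x, y)|%:E < +oo)%E.
  move=> mu uf; apply: le_lt_trans fi.
  have mn : measurable_fun setT (fun p => (normc (f p))%:E).
    by apply/measurable_EFinP; exact: measurable_fun_normc.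
  have mun : measurable_fun setT (fun p => (`|u p|)%:E).
    by apply/measurable_EFinP; exact: measurableT_comp.
  rewrite -(@fubini_tonelli1 _ _ _ _ _ m1 m2 (fun p => `|u p|%:E))//.
  rewrite -(@fubini_tonelli1 _ _ _ _ _ m1 m2 (fun p => (normc (f p))%:E))//; last first.
    by move=> p; rewrite lee_fin.
  apply: ge0_le_integral => //.
  by move=> p _; rewrite lee_fin.
apply: complexP; rewrite /cint /=.
  apply: (@Rfubini (fun p => complex.Re (f p))).
  - exact: measurable_fun_Re.
  - apply: (le (fun p => complex.Re (f p))); first exact: measurable_fun_Re.
    by move=> p; exact: ler_Re_normc.
  - by move=> x; exact: cintegrable_Re.
  - by move=> y; exact: (@cintegrable_Re _ _ _ _ (fun x => f (x, y))).
apply: (@Rfubini (fun p => complex.Im (f p))).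
- exact: measurable_fun_Im.
- apply: (le (fun p => complex.Im (f p))); first exact: measurable_fun_Im.
  by move=> p; exact: ler_Im_normc.
- by move=> x; exact: cintegrable_Im.
- by move=> y; exact: (@cintegrable_Im _ _ _ _ (fun x => f (x, y))).
Qed.

End complex_fubini.

(** * The Gaussian measure and its mean value property *)

#[export] Hint Extern 0 (is_true (Order.le _ (EFin (normc _)))) =>
  (rewrite lee_fin; exact: normc_ge0) : core.

Section gauss_measure.
Variable R : realType.
Local Notation C := R[i].

Lemma gauss_setT : @gauss R setT = 1%E.
Proof.
have := @integral_gauss_exp R 0 0; rewrite addr0 => /(_ ltr01).
under eq_integral do rewrite mul0r mul0r /= mulr0 subr0 expR0.
rewrite integral_cst// mul1e => ->.
by rewrite invr1 normc_zero expr0n mul0r expR0 mulr1.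
Qed.

(** [gauss] as a constant set function: it is convertible to [gauss] and can
    carry the instance of probability measure that Fubini's theorem needs. *)
Definition gauss_prob : set C -> \bar R :=
  density_measure planar_lebesgue (@measurable_gauss_weight R) (@gauss_weight_ge0 R).
HB.instance Definition _ := Measure.on gauss_prob.
HB.instance Definition _ := Measure_isProbability.Build _ _ R gauss_prob gauss_setT.

(** Change of variables, [m2] being the image of [m1] under [phi]. *)
Lemma ge0_integral_change d1 d2 (T1 : measurableType d1) (T2 : measurableType d2)
  (m1 : {measure set T1 -> \bar R}) (m2 : {measure set T2 -> \bar R})
  (phi : T1 -> T2) (f : T2 -> \bar R) :
  measurable_fun setT phi ->
  (forall A, measurable A -> m1 (phi @^-1` A) = m2 A) ->
  measurable_fun setT f -> (forall x, 0 <= f x)%E ->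
  (\int[m1]_x f (phi x) = \int[m2]_x f x)%E.
Proof.
move=> mphi pm mf f0; rewrite -[LHS](ge0_integral_pushforward mphi m1 measurableT mf)//.
by apply: eq_measure_integral => A mA _; exact: pm.
Qed.

Lemma measurable_mulc (u : C) : measurable_fun setT (fun z : C => u * z).
Proof. by apply: measurable_fun_cM => //; exact: measurable_cst. Qed.

Lemma measurable_addc (a : C) : measurable_fun setT (fun z : C => z + a).
Proof. by apply: measurable_fun_cD => //; exact: measurable_cst. Qed.

Lemma gauss_rotation (u : C) (A : set C) : normc u = 1 -> measurable A ->
  gauss ((fun z => u * z) @^-1` A) = gauss A.
Proof.
move=> u1 mA; have mw : measurable_fun setT (fun z : C => (gauss_weight z)%:E).
  by apply/measurable_EFinP; exact: measurable_gauss_weight.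
rewrite /gauss /= /density_measure.
transitivity (\int[pushforward planar_lebesgue (fun z => u * z)%R]_(z in A)
    (gauss_weight z)%:E)%E.
  rewrite [RHS]ge0_integral_pushforward//.
  - apply: eq_integral => z _ /=; rewrite /gauss_weight normcM u1 mul1r//.
  - exact: measurable_mulc.
  - exact: measurable_funTS.
  - by move=> z _; rewrite lee_fin gauss_weight_ge0.
apply: eq_measure_integral; first exact: measurable_mulc.
by move=> ? B mB _; exact: planar_rotation.
Qed.

(** The density of the translate of the Gaussian measure by [a]. *)
Definition weyl_weight (a z : C) : R :=
  expR (2 * complex.Re (z * a^*) - normc a ^+ 2).

Lemma weyl_weight_ge0 a z : 0 <= weyl_weight a z.
Proof. exact: expR_ge0. Qed.

Lemma measurable_weyl_weight a : measurable_fun setT (weyl_weight a).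
Proof.
apply: measurableT_comp => //; apply: measurable_funB => //.
apply: measurable_funM => //; apply: measurable_fun_Re.
by apply: measurable_fun_cM => //; exact: measurable_cst.
Qed.

Lemma gauss_translation (a : C) (A : set C) : measurable A ->
  gauss ((fun z => z + a) @^-1` A) =
  density_measure gauss (measurable_weyl_weight a) (weyl_weight_ge0 a) A.
Proof.
move=> mA; have mw : measurable_fun setT (fun z : C => (gauss_weight z)%:E).
  by apply/measurable_EFinP; exact: measurable_gauss_weight.
have mww : measurable_fun setT (fun z : C => (weyl_weight a z)%:E).
  by apply/measurable_EFinP; exact: measurable_weyl_weight.
rewrite [RHS]/density_measure integral_density//; last exact: measurable_funTS.
rewrite /gauss /= /density_measure.
transitivity (\int[pushforward planar_lebesgue (fun z => z + a)%R]_(z in A)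
    ((weyl_weight a z)%:E * (gauss_weight z)%:E))%E.
  rewrite [RHS]ge0_integral_pushforward//.
  - apply: eq_integral => z _ /=; rewrite /gauss_weight -EFinM mulrCA -expRD.
    congr (_ * expR _)%:E; rewrite !sqr_normcE ReM ReD ImD Re_conj Im_conj; ring.
  - exact: measurable_addc.
  - by apply: measurable_funTS; exact: emeasurable_funM.
  - by move=> z _; rewrite mule_ge0// lee_fin ?gauss_weight_ge0// weyl_weight_ge0.
apply: eq_measure_integral; first exact: measurable_addc.
by move=> ? B mB _; exact: planar_translation.
Qed.

Lemma cint_change d1 d2 (T1 : measurableType d1) (T2 : measurableType d2)
  (m1 : {measure set T1 -> \bar R}) (m2 : {measure set T2 -> \bar R})
  (phi : T1 -> T2) (f : T2 -> C) :
  measurable_fun setT phi ->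
  (forall A, measurable A -> m1 (phi @^-1` A) = m2 A) ->
  measurable_fun setT f -> cintegrable m1 (fun x => f (phi x)) ->
  cint m1 (fun x => f (phi x)) = cint m2 f.
Proof.
move=> mphi m12 mf fi.
have E (u : T2 -> R) : measurable_fun setT u ->
    m1.-integrable setT (EFin \o (fun x => u (phi x))) ->
    \int[m1]_x u (phi x) = \int[m2]_x u x.
  move=> mu ui; rewrite /Rintegral; congr fine.
  rewrite -[LHS](@integral_pushforward _ _ _ _ _ phi mphi m1 setT (EFin \o u))//; last first.
    exact/measurable_EFinP.
  by apply: eq_measure_integral => A mA _; exact: m12.
apply: complexP; rewrite /cint /=.
  by apply: (E (fun x => complex.Re (f x))); [exact: measurable_fun_Re|exact: cintegrable_Re].
by apply: (E (fun x => complex.Im (f x))); [exact: measurable_fun_Im|exact: cintegrable_Im].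
Qed.

Lemma cint_density d (T : measurableType d) (m : {measure set T -> \bar R}) (w : T -> R)
  (mw : measurable_fun setT w) (w0 : forall x, 0 <= w x) (f : T -> C) :
  measurable_fun setT f ->
  cint (density_measure m mw w0) f = cint m (fun x => f x * (w x)%:C).
Proof.
move=> mf; apply: complexP; rewrite /cint /= /Rintegral; congr fine.
  rewrite integral_density//; last by apply/measurable_EFinP; exact: measurable_fun_Re.
  by apply: eq_integral => x _; rewrite mulrC ReZ mulrC EFinM.
rewrite integral_density//; last by apply/measurable_EFinP; exact: measurable_fun_Im.
by apply: eq_integral => x _; rewrite mulrC ImZ mulrC EFinM.
Qed.

End gauss_measure.

Section mean_value.
Variable R : realType.
Local Notation C := R[i].
Local Notation lambda := (@lebesgue_measure R).
Implicit Types H h : C -> C.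

Lemma cintegrable_rotation (u : C) H : normc u = 1 -> cintegrable gauss H ->
  cintegrable gauss (fun z => H (u * z)).
Proof.
move=> u1 [mH Hi]; split; first exact: (measurableT_comp mH (measurable_mulc u)).
rewrite (@ge0_integral_change _ _ _ _ _ gauss gauss (fun z => u * z)
  (fun z => (normc (H z))%:E))//.
- exact: measurable_mulc.
- by move=> A mA; exact: gauss_rotation.
- by apply/measurable_EFinP; exact: measurable_fun_normc.
Qed.

Lemma cint_rotation (u : C) H : normc u = 1 -> cintegrable gauss H ->
  cint gauss (fun z => H (u * z)) = cint gauss H.
Proof.
move=> u1 Hi; apply: (cint_change (measurable_mulc u)).
- by move=> A mA; exact: gauss_rotation.
- exact: Hi.1.
- exact: cintegrable_rotation.
Qed.

Let cint_seg (phi : R -> C) a b :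
  cint lambda (fun t => (\1_(`[a, b]%classic) t)%:C * phi t) = cseg a b phi.
Proof.
apply: complexP; rewrite /cint /cseg /=.
  rewrite [RHS]Rintegral_mkcond; apply: eq_Rintegral => t _.
  by rewrite ReZ patchE indicE; case: ifPn => _; rewrite ?mul1r ?mul0r.
rewrite [RHS]Rintegral_mkcond; apply: eq_Rintegral => t _.
by rewrite ImZ patchE indicE; case: ifPn => _; rewrite ?mul1r ?mul0r.
Qed.

Let cintegrable_seg (phi : R -> C) a b : ccont phi ->
  cintegrable lambda (fun t => (\1_(`[a, b]%classic) t)%:C * phi t).
Proof.
move=> [c1 c2].
have mphi : measurable_fun setT phi.
  by apply: measurable_fun_complex; exact: continuous_measurable_fun.
pose u t := `|complex.Re (phi t)| + `|complex.Im (phi t)|.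
have cu : continuous u.
  by move=> t; apply: cvgD; apply: cvg_norm; [exact: c1|exact: c2].
apply: (@cintegrable_le _ _ _ lambda (fun t => (\1_(`[a, b]%classic) t)%:C * phi t)
  (fun t => \1_(`[a, b]%classic) t * u t)).
- by apply: measurable_fun_cM => //; apply: measurable_fun_real; exact: measurable_indic.
- apply: measurable_funM; first exact: measurable_indic.
  exact: continuous_measurable_fun.
- move=> t; rewrite normcM normc_real ger0_norm ?indicE//.
  by rewrite ler_wpM2l// ler_normc_ReIm.
have /(integrable_lty measurableT) : lambda.-integrable setT ((EFin \o u) \_ `[a, b]).
  rewrite -(@integrable_mkcond _ _ _ lambda `[a, b]%classic (EFin \o u))//.
  exact: continuous_integrable_itv.
congr (_ < _)%E; apply: eq_integral => t _.
by rewrite patchE indicE; case: ifPn => _; rewrite ?mul1r ?mul0r.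
Qed.

Lemma cint_gauss_cst (c : C) : cint gauss (fun=> c) = c.
Proof.
by apply: complexP; rewrite /cint /= Rintegral_cst// gauss_setT mulr1.
Qed.

(** The mean value property for the Gaussian measure: average the rotation
    invariance of the measure over all angles. *)
Lemma gauss_mean_value H : entire H -> cintegrable gauss H ->
  cint gauss H = H 0.
Proof.
move=> eH Hi; have mH := measurable_entire eH.
pose D : set R := `[0, pi *+ 2]%classic.
pose F (p : R * C) : C := (\1_D p.1)%:C * H (expC (0 +i* p.1) * p.2).
have e1 (t : R) : normc (expC (0 +i* t)) = 1 by rewrite normc_expC /= expR0.
have pi2 : 0 < (pi : R) *+ 2 by rewrite mulrn_wgt0// pi_gt0.
have mF : measurable_fun setT F.
  apply: measurable_fun_cM.
    by apply: measurable_fun_real; apply: measurableT_comp => //;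
      apply: measurable_indic; exact: measurable_itv.
  have mE : measurable_fun setT (fun p : R * C => expC (0 +i* p.1) * p.2).
    apply: measurable_fun_cM => //.
    apply: measurable_fun_expC; apply: measurable_fun_complex => /=.
      exact: measurable_cst.
    exact: measurable_fst.
  exact: (measurableT_comp mH mE).
have Ft t : cintegrable gauss (fun z => F (t, z)).
  exact: (cintegrableZ (\1_D t)%:C (cintegrable_rotation (e1 t) Hi)).
have Fz z : cintegrable lambda (fun t => F (t, z)).
  exact: (cintegrable_seg 0 (pi *+ 2)
    (entire_ccont_ver 0 (entire_comp eH (entireM (@entire_expC R) (@entire_cst R z))))).
have Ftz : (\int[lambda]_t \int[@gauss_prob R]_z (normc (F (t, z)))%:E < +oo)%E.
  have [N N0 NE] : exists2 N : R, 0 <= N & (\int[gauss]_z (normc (H z))%:E = N%:E)%E.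
    exists (fine (\int[gauss]_z (normc (H z))%:E)%E).
      by rewrite fine_ge0// integral_ge0// => z _; rewrite lee_fin.
    rewrite fineK// ge0_fin_numE; first exact: Hi.2.
    by rewrite integral_ge0// => z _; rewrite lee_fin.
  have E t : (\int[@gauss_prob R]_z (normc (F (t, z)))%:E = N%:E * (\1_D t)%:E)%E.
    rewrite /F /=; under eq_integral do rewrite normcM normc_real ger0_norm// EFinM.
    rewrite ge0_integralZl//.
    - rewrite muleC; congr (_ * _)%E; rewrite -NE.
      rewrite (@ge0_integral_change _ _ _ _ _ gauss gauss (fun z => expC (0 +i* t) * z)
        (fun z => (normc (H z))%:E))//.
      + exact: measurable_mulc.
      + by move=> A mA; exact: gauss_rotation.
      + by apply/measurable_EFinP; exact: measurable_fun_normc.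
    - apply/measurable_EFinP; apply: measurable_fun_normc.
      exact: (measurableT_comp mH (measurable_mulc _)).
  under eq_integral do rewrite E.
  rewrite ge0_integralZl//; last first.
    by apply/measurable_EFinP; apply: measurable_indic; exact: measurable_itv.
  rewrite integral_indic//; try exact: measurable_itv.
  have lD : lambda D = (pi *+ 2)%:E.
    have := @lebesgue_measure_itv R `[0, pi *+ 2].
    by rewrite /= lte_fin pi2 oppr0 adde0.
  rewrite setIT; have : (N%:E * lambda D < +oo)%E by rewrite lD -EFinM ltry.
  exact: id.
have := cint_fubini (m1 := lambda) (m2 := @gauss_prob R) mF Ftz Ft Fz.
have -> : cint lambda (fun t => cint (@gauss_prob R) (fun z => F (t, z))) =
    (pi *+ 2)%:C * cint gauss H.
  transitivity (cint lambda (fun t => (\1_D t)%:C * cint gauss H)).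
    apply: eq_cint => t.
    apply: (etrans (cintZ (\1_D t)%:C (cintegrable_rotation (e1 t) Hi))).
    by rewrite cint_rotation.
  rewrite cint_seg; apply/eqP; rewrite -subr_eq0; apply/eqP/normc_eq0/eqP.
  rewrite eq_le normc_ge0 andbT.
  have := @cseg_near _ 0 (pi *+ 2) (fun=> cint gauss H) (cint gauss H) 0 (ltW pi2).
  rewrite subr0 mulr0 mul0r; apply; first by split=> t; exact: cvg_cst.
  by move=> t _; rewrite subrr normc_zero.
have -> : cint (@gauss_prob R) (fun z => cint lambda (fun t => F (t, z))) = (pi *+ 2)%:C * H 0.
  transitivity (cint (@gauss R) (fun=> (pi *+ 2)%:C * H 0)).
    by apply: eq_cint => z; rewrite cint_seg circle_mean.
  exact: cint_gauss_cst.
move=> /mulfI; apply; apply/eqP => /(congr1 (@complex.Re R)) /= h.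
by move: pi2; rewrite h ltxx.
Qed.

End mean_value.

(** * The reproducing kernel *)

Section hilbert.
Variable R : realType.
Local Notation C := R[i].
Implicit Types f g h : C -> C.

Lemma sqr_integral_ge0 (m : {measure set C -> \bar R}) f : (0 <= sqr_integral m f)%E.
Proof. by apply: integral_ge0 => z _; rewrite lee_fin sqr_ge0. Qed.

Lemma sqr_integralE f : (sqr_integral gauss f < +oo)%E ->
  sqr_integral gauss f = (gauss_norm f ^+ 2)%:E.
Proof.
move=> fi; rewrite sqr_sqrtr ?fine_ge0 ?sqr_integral_ge0//.
by rewrite fineK// ge0_fin_numE// sqr_integral_ge0.
Qed.

Lemma gauss_norm_ge0 f : 0 <= gauss_norm f.
Proof. exact: sqrtr_ge0. Qed.

Lemma F2_L2 h : F2 h -> L2 h.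
Proof. by move=> [eh hi]; split => //; exact: measurable_entire. Qed.

Lemma le_integral_normcM f g : L2 f -> L2 g ->
  (\int[gauss]_z (normc (f z) * normc (g z))%:E <= (gauss_norm f * gauss_norm g)%:E)%E.
Proof.
move=> [mf fi] [mg gi].
have := ge0_cauchy_schwarz (m := gauss) (measurable_fun_normc mf) (measurable_fun_normc mg)
  (fun z => normc_ge0 _) (fun z => normc_ge0 _) (sqr_ge0 (gauss_norm f)) (sqr_ge0 (gauss_norm g)).
rewrite !sqrtr_sqr !ger0_norm ?gauss_norm_ge0//; apply.
  by rewrite -sqr_integralE.
by rewrite -sqr_integralE.
Qed.

Lemma cintegrable_L2M f g : L2 f -> L2 g -> cintegrable gauss (fun z => f z * g z).
Proof.
move=> Lf Lg; have [mf _] := Lf; have [mg _] := Lg.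
apply: (@cintegrable_le _ _ _ _ _ (fun z => normc (f z) * normc (g z))).
- exact: measurable_fun_cM.
- by apply: measurable_funM; exact: measurable_fun_normc.
- by move=> z; rewrite normcM.
- by apply: (le_lt_trans (le_integral_normcM Lf Lg)); rewrite ltry.
Qed.

Lemma L2_conj f : L2 f -> L2 (fun z => (f z)^*).
Proof.
move=> [mf fi]; split; first exact: measurable_fun_conj.
by move: fi; rewrite /sqr_integral; under [X in _ -> (X < _)%E]eq_integral do rewrite normc_conj.
Qed.

Lemma gauss_norm_conj f : gauss_norm (fun z => (f z)^*) = gauss_norm f.
Proof.
by rewrite /gauss_norm /sqr_integral; under eq_integral do rewrite normc_conj.
Qed.

Lemma cintegrable_inner f h : L2 f -> L2 h ->
  cintegrable gauss (fun z => f z * (h z)^*).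
Proof. by move=> Lf Lh; apply: cintegrable_L2M => //; exact: L2_conj. Qed.

Lemma gauss_inner_cint f h : gauss_inner f h = cint gauss (fun z => f z * (h z)^*).
Proof. by []. Qed.

Lemma le_normc_gauss_inner f h : L2 f -> L2 h ->
  normc (gauss_inner f h) <= gauss_norm f * gauss_norm h.
Proof.
move=> Lf Lh; rewrite -lee_fin gauss_inner_cint.
apply: (le_trans (le_normc_cint (cintegrable_inner Lf Lh))).
under eq_integral do rewrite normcM.
have := le_integral_normcM Lf (L2_conj Lh).
by rewrite gauss_norm_conj.
Qed.

Lemma gauss_inner_self f : L2 f -> gauss_inner f f = (gauss_norm f ^+ 2)%:C.
Proof.
move=> [mf fi]; apply: complexP => /=.
  rewrite -[RHS]/(fine (gauss_norm f ^+ 2)%:E) -sqr_integralE// /sqr_integral.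
  congr fine; apply: eq_integral => z _.
  by rewrite ReM Re_conj Im_conj mulrN opprK -!expr2 sqr_normcE.
transitivity (\int[@gauss R]_z (0 : R)); last by rewrite Rintegral_cst// mul0r.
by apply: eq_Rintegral => z _; rewrite ImM Re_conj Im_conj; ring.
Qed.

Lemma L2Z (c : C) f : L2 f -> L2 (fun z => c * f z).
Proof.
move=> [mf fi]; split; first by apply: measurable_fun_cM => //; exact: measurable_cst.
rewrite /sqr_integral; under eq_integral do rewrite normcM exprMn EFinM.
rewrite ge0_integralZl//.
- by rewrite lte_mul_pinfty// lee_fin sqr_ge0.
- by apply/measurable_EFinP; exact: measurable_sqr_normc.
- by move=> z _; rewrite lee_fin sqr_ge0.
- by rewrite lee_fin sqr_ge0.
Qed.

End hilbert.

Section reproducing.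
Variable R : realType.
Local Notation C := R[i].
Implicit Types f g h : C -> C.

Lemma measurable_kernelr (z : C) : measurable_fun setT (fun w : C => expC (z * w^*)).
Proof.
apply: measurable_fun_expC; apply: measurable_fun_cM; first exact: measurable_cst.
exact: measurable_fun_conj.
Qed.

Lemma integral_sqr_kernel (z : C) :
  (\int[gauss]_w (expR (2 * complex.Re (z * w^*)))%:E = (expR (normc z ^+ 2))%:E)%E.
Proof.
have := @integral_gauss_exp R 0 z; rewrite addr0 => /(_ ltr01).
by under eq_integral do rewrite mul0r subr0; rewrite invr1 mul1r mulr1.
Qed.

Lemma expR_sqr (x : R) : expR x ^+ 2 = expR (2 * x).
Proof. by rewrite expr2 -expRD; congr expR; ring. Qed.

Lemma L2_kernelr (z : C) : L2 (fun w : C => expC (z * w^*)).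
Proof.
split; first exact: measurable_kernelr.
rewrite /sqr_integral; under eq_integral do rewrite normc_expC expR_sqr.
by rewrite integral_sqr_kernel ltry.
Qed.

(** The exponential kernel reproduces the elements of the Bargmann space: apply
    the mean value property to [h (z + w)] times the exponential of [- z] times
    the conjugate of [w]. *)
Lemma reproducing h (w : C) : F2 h ->
  cint gauss (fun z => h z * expC (w * z^*)) = h w.
Proof.
move=> Fh; have Lh := F2_L2 Fh; have [eh hi] := Fh.
pose G z := h z * expC (- (z - w) * w^*).
have eE : entire (fun z : C => expC ((- w^*) * z + w * w^*)).
  exact: (entire_comp (@entire_expC R) (entireD (entireM (@entire_cst R (- w^*))
    (@entire_id R)) (@entire_cst R (w * w^*)))).
have eG : entire G.
  have := entireM eh eE; congr entire; apply/funext => z; congr (_ * expC _); ring.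
have eGw : entire (fun z => G (z + w)).
  exact: (entire_comp eG (entireD (@entire_id R) (@entire_cst R w))).
have GE z : G z * (weyl_weight w z)%:C = h z * expC (w * z^*).
  rewrite /G -mulrA; congr (_ * _).
  have -> : (weyl_weight w z)%:C = expC (2 * complex.Re (z * w^*) - normc w ^+ 2)%:C.
    by rewrite /expC /= cos0 sin0 mulr1.
  rewrite -expCD; congr expC; apply: complexP.
    rewrite !(ReD, ImD, ReM, ImM, ReN, ImN, Re_conj, Im_conj) sqr_normcE /=; ring.
  by rewrite !(ReD, ImD, ReM, ImM, ReN, ImN, Re_conj, Im_conj) /=; ring.
have hk := cintegrable_L2M Lh (L2_kernelr w).
have mG := measurable_entire eG.
have mGE : measurable_fun setT (fun z => (normc (G z))%:E).
  by apply/measurable_EFinP; exact: measurable_fun_normc.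
have Gi : cintegrable gauss (fun z => G (z + w)).
  split; first exact: measurable_entire.
  have change := @ge0_integral_change _ _ _ _ _ gauss _ (fun z : C => z + w)
    (fun z => (normc (G z))%:E) (measurable_addc w) (gauss_translation w) mGE.
  rewrite change//.
  rewrite integral_density//.
  have := hk.2; congr (_ < _)%E; apply: eq_integral => z _.
  by rewrite -GE normcM normc_real ger0_norm ?EFinM// weyl_weight_ge0.
transitivity (cint gauss (fun z => G z * (weyl_weight w z)%:C)).
  by apply: eq_cint => z; rewrite GE.
rewrite -(cint_density gauss (measurable_weyl_weight w) (weyl_weight_ge0 w) mG).
rewrite -(@cint_change _ _ _ _ _ gauss _ (fun z : C => z + w))//.
- by rewrite gauss_mean_value// add0r /G subrr oppr0 mul0r expC0 mulr1.
- exact: measurable_addc.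
- by move=> A mA; exact: gauss_translation.
Qed.

End reproducing.

(** * Entire functions given by integrals *)

Lemma normcM_expC (R : realType) (a b : R[i]) :
  normc (a * expC b) = normc a * expR (complex.Re b).
Proof. by rewrite [LHS]normcM normc_expC. Qed.

Section entire_parameter_integral.
Variable R : realType.
Local Notation C := R[i].
Variable phi : C -> C.
Hypothesis phi_int : forall z : C, cintegrable gauss (fun w => phi w * expC (z * w^*)).

(* The corners [+-2 +-2i]. *)
Let corner (b1 b2 : bool) : C := ((-1) ^+ b1 * 2) +i* ((-1) ^+ b2 * 2).

Let u (z w : C) : R := \sum_(b1 : bool) \sum_(b2 : bool)
   normc (phi w * expC ((z + corner b1 b2) * w^*)).

Let uE z w : u z w =
  normc (phi w * expC ((z + corner true true) * w^*)) +
  normc (phi w * expC ((z + corner true false) * w^*)) +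
  (normc (phi w * expC ((z + corner false true) * w^*)) +
  normc (phi w * expC ((z + corner false false) * w^*))).
Proof. by rewrite /u !big_bool. Qed.

Let mu z : measurable_fun setT (u z).
Proof.
have m b1 b2 : measurable_fun setT (fun w => normc (phi w * expC ((z + corner b1 b2) * w^*))).
  by apply: measurable_fun_normc; have [] := phi_int (z + corner b1 b2).
have := measurable_funD (measurable_funD (m true true) (m true false))
  (measurable_funD (m false true) (m false false)).
by congr (measurable_fun _ _); apply/funext => w; rewrite uE.
Qed.

Let u_ge0 z w : 0 <= u z w.
Proof. by rewrite uE !addr_ge0. Qed.

Let u_fin z : (\int[gauss]_w (u z w)%:E < +oo)%E.
Proof.
have i b1 b2 := phi_int (z + corner b1 b2).
have n b1 b2 : measurable_fun setT (fun w => (normc (phi w * expC ((z + corner b1 b2) * w^*)))%:E).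
  by apply/measurable_EFinP; apply: measurable_fun_normc; have [] := i b1 b2.
pose N b1 b2 w := (normc (phi w * expC ((z + corner b1 b2) * w^*)))%:E.
have sum2 b1 b2 b3 b4 : (\int[gauss]_w (N b1 b2 w + N b3 b4 w) < +oo)%E.
  rewrite ge0_integralD//; try exact: n; try by move=> w _; rewrite lee_fin.
  by apply: lte_add_pinfty; have [] := i b1 b2; have [] := i b3 b4.
have N0 b1 b2 b3 b4 w : (0 <= N b1 b2 w + N b3 b4 w)%E by rewrite adde_ge0// lee_fin.
rewrite (eq_integral (fun w => (N true true w + N true false w) +
    (N false true w + N false false w)))%E;
  last by move=> w _; rewrite uE !EFinD.
rewrite ge0_integralD//; try by [apply: emeasurable_funD; exact: n|move=> w _].
by apply: lte_add_pinfty; exact: sum2.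
Qed.

Let exp_le (x : R) : expR (2 * `|x|) <= expR (2 * x) + expR (- (2 * x)).
Proof.
have [x0|x0] := leP 0 x; first by rewrite ger0_norm// lerDl expR_ge0.
by rewrite ltr0_norm// mulrN lerDr expR_ge0.
Qed.

(** The modulus of the integrand times [e^(2 |w|)] is dominated by the moduli
    of the integrands at the four corners of a square around [z]. *)
Let le_u z w : normc (phi w * expC (z * w^*)) * expR (2 * normc w) <= u z w.
Proof.
case: w => x y.
have e2 : expR (2 * normc (x +i* y)) <=
   (expR (2 * x) + expR (- (2 * x))) * (expR (2 * y) + expR (- (2 * y))).
  apply: (@le_trans _ _ (expR (2 * `|x|) * expR (2 * `|y|))).
    by rewrite -expRD ler_expR -mulrDr ler_wpM2l// (ler_normc_ReIm (x +i* y)).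
  by apply: ler_pM; rewrite ?expR_ge0.
have ge0 := normc_ge0 (phi (x +i* y) * expC (z * (x +i* y)^*)).
apply: (le_trans (ler_wpM2l ge0 e2)).
rewrite uE !normcM_expC le_eqVlt; apply/orP; left; apply/eqP.
have E b1 b2 : expR (complex.Re ((z + corner b1 b2) * (x +i* y)^*)) =
   expR (complex.Re (z * (x +i* y)^*)) * (expR ((-1) ^+ b1 * 2 * x) * expR ((-1) ^+ b2 * 2 * y)).
  by rewrite -!expRD; congr expR; rewrite mulrDl ReD [X in _ + X]ReM /=; ring.
rewrite !E /= !expr1 !expr0 !mul1r !mulN1r !mulNr; ring.
Qed.

Let sqr_le_exp (x : R) : 0 <= x -> x ^+ 2 * expR x <= 4 * expR (2 * x).
Proof.
move=> x0; have -> : expR (2 * x) = expR x * expR x by rewrite -expRD; congr expR; ring.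
rewrite mulrA ler_wpM2r ?expR_ge0//.
have -> : expR x = expR (x / 2) ^+ 2 by rewrite expR_sqr; congr expR; field.
have h := expR_ge1Dx (x / 2).
have h2 : x / 2 <= expR (x / 2) by apply: le_trans h; rewrite lerDr.
have -> : x ^+ 2 = 4 * (x / 2) ^+ 2 by field.
by rewrite ler_wpM2l// ler_pXn2r// nnegrE ?expR_ge0// divr_ge0.
Qed.

(** Differentiation under the integral sign. *)
Lemma entire_cint_kernel :
  entire (fun z => cint gauss (fun w => phi w * expC (z * w^*))).
Proof.
have mp z : measurable_fun setT (fun w => phi w * expC (z * w^*)).
  by have [] := phi_int z.
have mw : measurable_fun setT (fun w : C => w^*) by exact: measurable_fun_conj.
move=> z; pose d := cint gauss (fun w => phi w * expC (z * w^*) * w^*).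
have di : cintegrable gauss (fun w => phi w * expC (z * w^*) * w^*).
  apply: (@cintegrable_le _ _ _ _ _ (u z)) => //.
    exact: measurable_fun_cM.
  move=> w; rewrite normcM normc_conj; apply: le_trans (le_u z w).
  rewrite ler_wpM2l//; apply: (@le_trans _ _ (1 + 2 * normc w)).
    by have := normc_ge0 w; lra.
  exact: expR_ge1Dx.
pose K := fine (\int[gauss]_w (u z w)%:E)%E.
have KE : (\int[gauss]_w (u z w)%:E = K%:E)%E.
  rewrite fineK// ge0_fin_numE// integral_ge0// => w _.
  by rewrite lee_fin.
apply: (@cderiv_derivable _ _ _ d); apply: (@cderiv_quadratic _ _ _ _ (8 * K)) => h h1.
pose r w := phi w * expC (z * w^*) * (expC (h * w^*) - 1 - h * w^*).
have rle w : normc (r w) <= 8 * normc h ^+ 2 * u z w.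
  rewrite /r normcM; apply: (@le_trans _ _ (normc (phi w * expC (z * w^*)) *
     (8 * normc h ^+ 2 * expR (2 * normc w)))); last first.
    rewrite [leLHS]mulrCA; apply: ler_wpM2l; last exact: le_u.
    by rewrite mulr_ge0// sqr_ge0.
  rewrite ler_wpM2l//; apply: (le_trans (expC_taylor _)); rewrite normcM normc_conj.
  have -> : 8 * normc h ^+ 2 * expR (2 * normc w) =
    2 * normc h ^+ 2 * (4 * expR (2 * normc w)) by ring.
  rewrite exprMn mulrA -mulrA ler_wpM2l ?mulr_ge0 ?sqr_ge0//.
  apply: le_trans (sqr_le_exp (normc_ge0 w)).
  by rewrite ler_wpM2l ?sqr_ge0// ler_expR ler_piMl// ltW.
have mr : measurable_fun setT r.
  apply: measurable_fun_cM => //; apply: measurable_fun_cB.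
    apply: measurable_fun_cB; last exact: measurable_cst.
    by apply: measurable_fun_expC; apply: measurable_fun_cM => //; exact: measurable_cst.
  by apply: measurable_fun_cM => //; exact: measurable_cst.
have h80 : 0 <= 8 * normc h ^+ 2 by rewrite mulr_ge0// sqr_ge0.
have uh : (\int[gauss]_w (8 * normc h ^+ 2 * u z w)%:E = (8 * normc h ^+ 2 * K)%:E)%E.
  under eq_integral do rewrite EFinM.
  by rewrite ge0_integralZl// ?KE//; [exact/measurable_EFinP|move=> w _; rewrite lee_fin].
have ri : cintegrable gauss r.
  apply: (@cintegrable_le _ _ _ _ _ (fun w => 8 * normc h ^+ 2 * u z w)) => //.
    by apply: measurable_funM.
  by rewrite uh ltry.
have -> : cint gauss (fun w => phi w * expC ((z + h) * w^*)) -
    cint gauss (fun w => phi w * expC (z * w^*)) - d * h = cint gauss r.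
  have -> : cint gauss (fun w => phi w * expC ((z + h) * w^*)) =
    cint gauss (fun w => (phi w * expC (z * w^*) + h * (phi w * expC (z * w^*) * w^*)) + r w).
    by apply: eq_cint => w; rewrite /r mulrDl expCD; ring.
  rewrite cintD//; last by apply: cintegrableD => //; exact: cintegrableZ.
  rewrite cintD//; last exact: cintegrableZ.
  by rewrite cintZ// -/d; ring.
rewrite -lee_fin; apply: (le_trans (le_normc_cint ri)).
have -> : 8 * K * normc h ^+ 2 = 8 * normc h ^+ 2 * K by ring.
rewrite -uh; apply: ge0_le_integralT.
- exact: measurable_fun_normc.
- by apply: measurable_funM.
- by move=> w; rewrite normc_ge0 rle.
Qed.

End entire_parameter_integral.

(** * The kernel test *)

Section schur.
Variable R : realType.
Local Notation C := R[i].
Implicit Types f g h : C -> C.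

(** [K] bounds the Berezin transform of [|g|^2], that is the integrals of [|g|^2]
    against the squared moduli of the normalized kernels; the factor
    [e^(- |a|^2)] of the latter is on the right-hand side. *)
Definition berezin_bounded g (K : R) : Prop := forall a : C,
  (\int[gauss]_w (normc (g w) ^+ 2 * expR (2 * complex.Re (w * a^*)))%:E <=
   (K * expR (normc a ^+ 2))%:E)%E.

Lemma Re_mul_conjC (z w : C) : complex.Re (z * w^*) = complex.Re (w * z^*).
Proof. by rewrite !ReM !Re_conj !Im_conj; ring. Qed.

Lemma measurable_Re_mul_conj : measurable_fun setT
  (fun p : C * C => complex.Re (p.1 * p.2^*)).
Proof.
apply: measurable_fun_Re; apply: measurable_fun_cM; first exact: measurable_fst.
by apply: measurable_fun_conj; exact: measurable_snd.
Qed.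

Lemma measurable_Re_mulr_conj (z : C) :
  measurable_fun setT (fun w : C => complex.Re (z * w^*)).
Proof.
apply: measurable_fun_Re; apply: measurable_fun_cM; first exact: measurable_cst.
exact: measurable_fun_conj.
Qed.

Lemma measurable_sqr_normc_id : measurable_fun setT (fun z : C => normc z ^+ 2).
Proof. by apply: measurable_sqr_normc; exact: measurable_id. Qed.

Lemma gauss_tonelli (F : C * C -> R) : measurable_fun setT F ->
  (forall p, 0 <= F p) ->
  (\int[gauss]_x \int[gauss]_y (F (x, y))%:E =
   \int[gauss]_y \int[gauss]_x (F (x, y))%:E)%E.
Proof.
move=> mF F0.
apply: (@fubini_tonelli _ _ _ _ _ (@gauss_prob R) (@gauss_prob R) (EFin \o F)).
  exact/measurable_EFinP.
by move=> p; rewrite lee_fin.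
Qed.

(** The test function [e^(|w|^2 / 2)] times the modulus of the kernel is a
    Gaussian average of the exponentials occurring in [berezin_bounded]. *)
Lemma exp_half_gauss (z w : C) :
  (\int[gauss]_a (expR (2 * complex.Re ((w + z) * a^*) - normc a ^+ 2))%:E =
  (2^-1 * expR (normc z ^+ 2 / 2) *
   expR (normc w ^+ 2 / 2 + complex.Re (z * w^*)))%:E)%E.
Proof.
have := @integral_gauss_exp R 1 (w + z); rewrite addr_gt0// => /(_ isT).
under eq_integral do rewrite mul1r.
move=> ->; rewrite -mulrA -expRD; congr (_ * expR _)%:E.
by rewrite !sqr_normcE ReM Re_conj Im_conj ReD ImD; field.
Qed.

Lemma integral_kernel_test (w : C) :
  (\int[gauss]_z (expR (normc z ^+ 2 / 2 + complex.Re (z * w^*)))%:E =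
  (2 * expR (normc w ^+ 2 / 2))%:E)%E.
Proof.
have h : (0 < 1 + - 2^-1 :> R) by lra.
have := @integral_gauss_exp R (- 2^-1) (2^-1%:C * w) h.
have -> : (1 + - 2^-1 : R) = 2^-1 by field.
rewrite invrK normcM normc_real ger0_norm ?invr_ge0// exprMn.
have -> : (2^-1 ^+ 2 * normc w ^+ 2 * 2 = normc w ^+ 2 / 2 :> R) by field.
move=> <-; apply: eq_integral => z _; congr (expR _)%:E.
rewrite -mulrA ReZ (Re_mul_conjC z w); by field.
Qed.

(** The test function controls one half of Schur's test for the symbol [g]. *)
Lemma berezin_kernel_test g (K : R) : measurable_fun setT g -> 0 <= K ->
  berezin_bounded g K -> forall z : C,
  (\int[gauss]_w (normc (g w) ^+ 2 *
     expR (normc w ^+ 2 / 2 + complex.Re (z * w^*)))%:E <=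
   (2 * K * expR (normc z ^+ 2 / 2))%:E)%E.
Proof.
move=> mg K0 gK z; pose e := 2^-1 * expR (normc z ^+ 2 / 2).
have e0 : 0 < e by rewrite mulr_gt0 ?expR_gt0// invr_gt0.
have mRz : measurable_fun setT (fun p : C * C => complex.Re ((p.1 + z) * p.2^*)).
  apply: measurable_fun_Re; apply: measurable_fun_cM.
    by apply: measurable_fun_cD; [exact: measurable_fst|exact: measurable_cst].
  by apply: measurable_fun_conj; exact: measurable_snd.
have mg2 := measurable_sqr_normc mg.
pose F (p : C * C) := normc (g p.1) ^+ 2 *
   expR (2 * complex.Re ((p.1 + z) * p.2^*) - normc p.2 ^+ 2).
have mF : measurable_fun setT F.
  apply: measurable_funM; first exact: (measurableT_comp mg2 measurable_fst).
  apply: measurableT_comp => //; apply: measurable_funB.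
    by apply: measurable_funM => //.
  exact: (measurableT_comp measurable_sqr_normc_id measurable_snd).
have mt : measurable_fun setT (fun w => normc (g w) ^+ 2 *
     expR (normc w ^+ 2 / 2 + complex.Re (z * w^*))).
  apply: measurable_funM => //; apply: measurableT_comp => //; apply: measurable_funD.
    by apply: measurable_funM => //; exact: measurable_sqr_normc_id.
  exact: measurable_Re_mulr_conj.
rewrite -(@lee_pmul2l _ e%:E)// -ge0_integralZl//; last 3 first.
- exact/measurable_EFinP.
- by move=> w _; rewrite lee_fin mulr_ge0 ?sqr_ge0 ?expR_ge0.
- by rewrite lee_fin ltW.
have -> : (\int[gauss]_w (e%:E * (normc (g w) ^+ 2 *
     expR (normc w ^+ 2 / 2 + complex.Re (z * w^*)))%:E) =
  \int[gauss]_w \int[gauss]_a (F (w, a))%:E)%E.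
  apply: eq_integral => w _; rewrite /F /=.
  under eq_integral do rewrite EFinM.
  rewrite ge0_integralZl//.
  - by rewrite exp_half_gauss -!EFinM; congr EFin; rewrite /e; ring.
  - apply/measurable_EFinP; apply: measurableT_comp => //; apply: measurable_funB.
      by apply: measurable_funM => //; exact: measurable_Re_mulr_conj.
    exact: measurable_sqr_normc_id.
  - by rewrite lee_fin sqr_ge0.
rewrite gauss_tonelli//; last by move=> p; rewrite mulr_ge0 ?sqr_ge0 ?expR_ge0.
apply: (@le_trans _ _ (\int[gauss]_a (K * expR (2 * complex.Re (z * a^*)))%:E)%E).
  have ma (a : C) : measurable_fun setT
      (fun w => normc (g w) ^+ 2 * expR (2 * complex.Re (w * a^*))).
    apply: measurable_funM => //; apply: measurableT_comp => //; apply: measurable_funM => //.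
    under eq_fun do rewrite Re_mul_conjC; exact: measurable_Re_mulr_conj.
  apply: ge0_le_integral => //.
  - by move=> a _; apply: integral_ge0 => w _; rewrite lee_fin mulr_ge0 ?sqr_ge0 ?expR_ge0.
  - have mFE : measurable_fun setT (EFin \o F) by exact/measurable_EFinP.
    have F0 p : (0 <= (EFin \o F) p)%E by rewrite lee_fin mulr_ge0 ?sqr_ge0 ?expR_ge0.
    exact: (@measurable_fun_fubini_tonelli_G _ _ _ _ _ (@gauss_prob R) (EFin \o F) mFE F0).
  - apply/measurable_EFinP; apply: measurable_funM => //; apply: measurableT_comp => //.
    by apply: measurable_funM => //; exact: measurable_Re_mulr_conj.
  move=> a _.
  have -> : (\int[gauss]_w (F (w, a))%:E = (expR (2 * complex.Re (z * a^*) - normc a ^+ 2))%:E *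
     \int[gauss]_w (normc (g w) ^+ 2 * expR (2 * complex.Re (w * a^*)))%:E)%E.
    rewrite -ge0_integralZl//.
    - apply: eq_integral => w _; rewrite -EFinM /F [in RHS]mulrCA -expRD.
      congr (_ * expR _)%:E; rewrite -[(w, a).1]/w -[(w, a).2]/a.
      have -> : complex.Re ((w + z) * a^*) = complex.Re (w * a^*) + complex.Re (z * a^*).
        by rewrite -ReD -mulrDl.
      by ring.
    - exact/measurable_EFinP.
    - by move=> w _; rewrite lee_fin mulr_ge0 ?sqr_ge0 ?expR_ge0.
  apply: (@le_trans _ _ ((expR (2 * complex.Re (z * a^*) - normc a ^+ 2))%:E *
      (K * expR (normc a ^+ 2))%:E)%E).
    by rewrite lee_wpmul2l ?lee_fin ?expR_ge0.
  by rewrite -EFinM lee_fin mulrCA -expRD subrK.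
under eq_integral do rewrite EFinM.
rewrite ge0_integralZl//.
- rewrite integral_sqr_kernel -!EFinM lee_fin /e.
  have -> : expR (normc z ^+ 2) = expR (normc z ^+ 2 / 2) ^+ 2.
    by rewrite expR_sqr; congr expR; field.
  by rewrite le_eqVlt; apply/orP; left; apply/eqP; field.
- apply/measurable_EFinP; apply: measurableT_comp => //; apply: measurable_funM => //.
  exact: measurable_Re_mulr_conj.
Qed.

End schur.

(** * Schur's test *)

Lemma measurable_gauss_integral (R : realType) (F : R[i] * R[i] -> R) :
  measurable_fun setT F -> (forall p, 0 <= F p) ->
  measurable_fun setT (fun x => \int[gauss]_y (F (x, y))%:E)%E.
Proof.
move=> mF F0.
have mE : measurable_fun setT (EFin \o F) by exact/measurable_EFinP.
have E0 p : (0 <= (EFin \o F) p)%E by rewrite lee_fin.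
exact: (@measurable_fun_fubini_tonelli_F _ _ _ _ _ (@gauss_prob R) (EFin \o F) mE E0).
Qed.

Section schur_operator.
Variable R : realType.
Local Notation C := R[i].
Variables (g : C -> C) (K : R).
Hypotheses (mg : measurable_fun setT g) (K0 : 0 <= K) (gK : berezin_bounded g K).
Implicit Types f h : C -> C.

(** The integral operator with symbol [g]: formally, the projection of [g f]. *)
Definition kernel_op f (z : C) : C :=
  cint gauss (fun w => g w * f w * expC (z * w^*)).

Lemma L2_mul_kernel (z : C) : L2 (fun w => g w * expC (z * w^*)).
Proof.
split; first by apply: measurable_fun_cM => //; exact: measurable_kernelr.
apply: (@le_lt_trans _ _ (K * expR (normc z ^+ 2))%:E); last by rewrite ltry.
apply: le_trans (gK z); rewrite le_eqVlt; apply/orP; left; apply/eqP.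
apply: eq_integral => w _; congr EFin.
by rewrite normcM_expC exprMn expR_sqr Re_mul_conjC.
Qed.

Lemma cintegrable_kernel_op f (z : C) : L2 f ->
  cintegrable gauss (fun w => g w * f w * expC (z * w^*)).
Proof.
move=> Lf; have := cintegrable_L2M (L2_mul_kernel z) Lf.
by congr cintegrable; apply/funext => w; rewrite mulrAC.
Qed.

Lemma entire_kernel_op f : L2 f -> entire (kernel_op f).
Proof.
by move=> Lf; apply: entire_cint_kernel => z; exact: cintegrable_kernel_op.
Qed.

(** The same integral with moduli inside: a positive operator dominating
    [kernel_op]. *)
Definition kernel_abs f (z : C) : \bar R :=
  (\int[gauss]_w (normc (g w) * normc (f w) * expR (complex.Re (z * w^*)))%:E)%E.

Let measurable_abs f : L2 f -> measurable_fun setT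
  (fun p : C * C => normc (g p.2) * normc (f p.2) * expR (complex.Re (p.1 * p.2^*))).
Proof.
move=> [mf _]; apply: measurable_funM; last first.
  by apply: measurableT_comp => //; exact: measurable_Re_mul_conj.
by apply: measurable_funM;
  [exact: (measurableT_comp (measurable_fun_normc mg) measurable_snd)
  |exact: (measurableT_comp (measurable_fun_normc mf) measurable_snd)].
Qed.

Lemma kernel_abs_ge0 f z : (0 <= kernel_abs f z)%E.
Proof.
by apply: integral_ge0 => w _; rewrite lee_fin !mulr_ge0// expR_ge0.
Qed.

Lemma kernel_abs_fin f z : L2 f -> kernel_abs f z \is a fin_num.
Proof.
move=> Lf; rewrite ge0_fin_numE ?kernel_abs_ge0//.
have := (cintegrable_kernel_op z Lf).2; congr (_ < _)%E; apply: eq_integral => w _.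
by rewrite normcM_expC normcM.
Qed.

Lemma measurable_kernel_abs f : L2 f -> measurable_fun setT (kernel_abs f).
Proof.
move=> Lf; apply: (measurable_gauss_integral (measurable_abs Lf)) => p.
by rewrite !mulr_ge0// expR_ge0.
Qed.

Lemma le_normc_kernel_op f z : L2 f ->
  normc (kernel_op f z) <= fine (kernel_abs f z).
Proof.
move=> Lf; rewrite -lee_fin fineK ?kernel_abs_fin//.
apply: (le_trans (le_normc_cint (cintegrable_kernel_op z Lf))).
by rewrite le_eqVlt; apply/orP; left; apply/eqP; apply: eq_integral => w _;
  rewrite normcM_expC normcM.
Qed.

(** Schur's test: the Cauchy-Schwarz inequality, after moving a weight
    [e^(|w|^2 / 4)] from the factor with [f] to the factor with [g]. *)
Lemma schur_test f : L2 f ->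
  (\int[gauss]_z ((fine (kernel_abs f z)) ^+ 2)%:E <=
   (4 * K * gauss_norm f ^+ 2)%:E)%E.
Proof.
move=> Lf; have [mf fi] := Lf.
pose q (p : C * C) := complex.Re (p.1 * p.2^*).
have mq : measurable_fun setT q by exact: measurable_Re_mul_conj.
pose B (z w : C) := normc (f w) ^+ 2 * expR (complex.Re (z * w^*) - normc w ^+ 2 / 2).
have B0 z w : 0 <= B z w by rewrite mulr_ge0 ?sqr_ge0 ?expR_ge0.
have mB : measurable_fun setT (fun p : C * C => B p.1 p.2).
  apply: measurable_funM; first exact: (measurableT_comp (measurable_sqr_normc mf) measurable_snd).
  apply: measurableT_comp => //; apply: measurable_funB => //; apply: measurable_funM => //.
  exact: (measurableT_comp (@measurable_sqr_normc_id R) measurable_snd).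
have mBz z : measurable_fun setT (B z).
  have mp : measurable_fun setT (fun w : C => (z, w)) by exact: measurable_fun_pair.
  exact: (measurableT_comp mB mp).
have mBw w : measurable_fun setT (fun z => B z w).
  have mp : measurable_fun setT (fun z : C => (z, w)) by exact: measurable_fun_pair.
  exact: (measurableT_comp mB mp).
have Bfin z : (\int[gauss]_w (B z w)%:E)%E \is a fin_num.
  rewrite ge0_fin_numE; last by apply: integral_ge0 => w _; rewrite lee_fin.
  apply: (@le_lt_trans _ _ (\int[gauss]_w (expR (normc z ^+ 2 / 2) * normc (f w) ^+ 2)%:E)%E).
    apply: ge0_le_integralT => //.
      by apply: measurable_funM => //; exact: measurable_sqr_normc.
    move=> w; rewrite B0/= /B mulrC ler_wpM2r ?sqr_ge0// ler_expR.
    rewrite ReM Re_conj Im_conj !sqr_normcE.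
    rewrite -subr_ge0 (_ : _ - _ = ((complex.Re z - complex.Re w) ^+ 2 +
      (complex.Im z - complex.Im w) ^+ 2) / 2); last by field.
    by rewrite divr_ge0// addr_ge0// sqr_ge0.
  under eq_integral do rewrite EFinM.
  rewrite ge0_integralZl//.
  - by rewrite lte_mul_pinfty// lee_fin expR_ge0.
  - by apply/measurable_EFinP; exact: measurable_sqr_normc.
  - by move=> w _; rewrite lee_fin sqr_ge0.
have step z : (fine (kernel_abs f z)) ^+ 2 <=
    2 * K * expR (normc z ^+ 2 / 2) * fine (\int[gauss]_w (B z w)%:E)%E.
  set M := 2 * K * _; set N := fine (\int[gauss]_w (B z w)%:E)%E.
  have M0 : 0 <= M by rewrite !mulr_ge0// expR_ge0.
  have N0 : 0 <= N by rewrite /N fine_ge0//; apply: integral_ge0 => w _; rewrite lee_fin.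
  pose a w := normc (g w) * expR ((normc w ^+ 2 / 2 + complex.Re (z * w^*)) / 2).
  pose b w := normc (f w) * expR ((complex.Re (z * w^*) - normc w ^+ 2 / 2) / 2).
  have mR := measurable_Re_mulr_conj z.
  have mn : measurable_fun setT (fun w : C => normc w ^+ 2 / 2).
    by apply: measurable_funM => //; exact: measurable_sqr_normc_id.
  have ma : measurable_fun setT a.
    apply: measurable_funM; first exact: measurable_fun_normc.
    by apply: measurableT_comp => //; apply: measurable_funM => //; exact: measurable_funD.
  have mb : measurable_fun setT b.
    apply: measurable_funM; first exact: measurable_fun_normc.
    by apply: measurableT_comp => //; apply: measurable_funM => //; exact: measurable_funB.
  have e2 (x : R) : expR (x / 2) ^+ 2 = expR x by rewrite expR_sqr; congr expR; field.
  have aM : (\int[gauss]_w (a w ^+ 2)%:E <= M%:E)%E.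
    apply: le_trans (berezin_kernel_test mg K0 gK z).
    rewrite le_eqVlt; apply/orP; left; apply/eqP; apply: eq_integral => w _.
    by rewrite /a exprMn e2.
  have bN : (\int[gauss]_w (b w ^+ 2)%:E <= N%:E)%E.
    rewrite fineK// le_eqVlt; apply/orP; left; apply/eqP; apply: eq_integral => w _.
    by rewrite /b exprMn e2.
  have a0 w : 0 <= a w by rewrite mulr_ge0// expR_ge0.
  have b0 w : 0 <= b w by rewrite mulr_ge0// expR_ge0.
  have := ge0_cauchy_schwarz ma mb a0 b0 M0 N0 aM bN.
  have -> : (\int[gauss]_w (a w * b w)%:E = (fine (kernel_abs f z))%:E)%E.
    rewrite fineK ?kernel_abs_fin//; apply: eq_integral => w _; congr EFin.
    by rewrite /a /b mulrACA -expRD; congr (_ * expR _); field.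
  rewrite lee_fin => h.
  have -> : M * N = (Num.sqrt M * Num.sqrt N) ^+ 2 by rewrite exprMn !sqr_sqrtr.
  have A0 : 0 <= fine (kernel_abs f z) by rewrite fine_ge0// kernel_abs_ge0.
  by rewrite !expr2; apply: ler_pM.
have mA2 : measurable_fun setT (fun z => fine (kernel_abs f z) ^+ 2).
  apply: measurable_funX; apply: measurableT_comp => //.
  exact: measurable_kernel_abs.
have mBi : measurable_fun setT (fun z => \int[gauss]_w (B z w)%:E)%E.
  by apply: (measurable_gauss_integral mB) => p.
have mez : measurable_fun setT (fun z : C => expR (normc z ^+ 2 / 2)).
  apply: measurableT_comp => //; apply: measurable_funM => //; exact: measurable_sqr_normc_id.
have mF : measurable_fun setT (fun p : C * C => expR (normc p.1 ^+ 2 / 2) * B p.1 p.2).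
  by apply: measurable_funM => //; exact: (measurableT_comp mez measurable_fst).
apply: (@le_trans _ _ (\int[gauss]_z ((2 * K)%:E *
    \int[gauss]_w (expR (normc z ^+ 2 / 2) * B z w)%:E))%E).
  apply: ge0_le_integral => //.
  - by move=> z _; rewrite lee_fin sqr_ge0.
  - exact/measurable_EFinP.
  - apply: emeasurable_funM => //.
    by apply: (measurable_gauss_integral mF) => p; rewrite mulr_ge0 ?expR_ge0.
  - move=> z _; under eq_integral do rewrite EFinM.
    rewrite ge0_integralZl//.
    + by rewrite -[X in (_ * (_ * X))%E]fineK// -!EFinM lee_fin mulrA; exact: step.
    + exact/measurable_EFinP.
    + by move=> w _; rewrite lee_fin.
rewrite ge0_integralZl//; first last.
- by rewrite lee_fin mulr_ge0.
- by move=> z _; apply: integral_ge0 => w _; rewrite lee_fin mulr_ge0 ?expR_ge0.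
- by apply: (measurable_gauss_integral mF) => p; rewrite mulr_ge0 ?expR_ge0.
rewrite (gauss_tonelli (F := fun p => expR (normc p.1 ^+ 2 / 2) * B p.1 p.2))//; last first.
  by move=> p; rewrite mulr_ge0 ?expR_ge0.
have -> : (\int[gauss]_w \int[gauss]_z (expR (normc z ^+ 2 / 2) * B z w)%:E =
  \int[gauss]_w (2%:E * (normc (f w) ^+ 2)%:E))%E.
  apply: eq_integral => w _.
  transitivity (\int[gauss]_z ((normc (f w) ^+ 2 * expR (- (normc w ^+ 2 / 2)))%:E *
    (expR (normc z ^+ 2 / 2 + complex.Re (z * w^*)))%:E))%E.
    apply: eq_integral => z _; rewrite /B -EFinM [in LHS]mulrCA -[in RHS]mulrA -!expRD.
    by congr (_ * expR _)%:E; ring.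
  rewrite ge0_integralZl//.
  - rewrite integral_kernel_test -!EFinM; congr EFin.
    have E : expR (- (normc w ^+ 2 / 2)) * expR (normc w ^+ 2 / 2) = 1.
      by rewrite -expRD addNr expR0.
    by rewrite mulrCA -mulrA E mulr1.
  - apply/measurable_EFinP; apply: measurableT_comp => //; apply: measurable_funD.
      by apply: measurable_funM => //; exact: measurable_sqr_normc_id.
    by under eq_fun do rewrite Re_mul_conjC; exact: measurable_Re_mulr_conj.
  - by rewrite lee_fin mulr_ge0 ?sqr_ge0 ?expR_ge0.
rewrite ge0_integralZl//; first last.
- by move=> w _; rewrite lee_fin sqr_ge0.
- by apply/measurable_EFinP; exact: measurable_sqr_normc.
rewrite -/(sqr_integral gauss f) sqr_integralE// -!EFinM lee_fin.
by rewrite le_eqVlt; apply/orP; left; apply/eqP; ring.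
Qed.

End schur_operator.

(** * The kernel operator and the Bargmann projection *)

Lemma conj_kernel (R : realType) (z w : R[i]) : (expC (w * z^*))^* = expC (z * w^*).
Proof.
rewrite expC_conj; congr expC.
by apply: complexP; rewrite ?(Re_conj, Im_conj) !(ReM, ImM) ?(Re_conj, Im_conj); ring.
Qed.

Lemma conjcM (R : realType) (z w : R[i]) : (z * w)^* = z^* * w^*.
Proof.
by apply: complexP; rewrite ?(Re_conj, Im_conj) !(ReM, ImM) ?(Re_conj, Im_conj); ring.
Qed.

Lemma ler_sqrtrM (R : rcfType) (K a b : R) : 0 <= K -> 0 <= a -> 0 <= b ->
  a ^+ 2 <= K * b ^+ 2 -> a <= Num.sqrt K * b.
Proof.
move=> K0 a0 b0; have -> : K * b ^+ 2 = (Num.sqrt K * b) ^+ 2.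
  by rewrite exprMn sqr_sqrtr.
by rewrite ler_pXn2r// nnegrE mulr_ge0.
Qed.

Section kernel_operator.
Variable R : realType.
Local Notation C := R[i].
Variables (g : C -> C) (K : R).
Hypotheses (mg : measurable_fun setT g) (K0 : 0 <= K) (gK : berezin_bounded g K).
Implicit Types f h : C -> C.

Lemma kernel_op_bound f : L2 f ->
  (sqr_integral gauss (kernel_op g f) <= (4 * K * gauss_norm f ^+ 2)%:E)%E.
Proof.
move=> Lf; apply: le_trans (schur_test mg K0 gK Lf).
apply: ge0_le_integralT.
- by apply: measurable_sqr_normc; apply: measurable_entire; exact: (entire_kernel_op mg gK).
- apply: measurable_funX; apply: measurableT_comp => //.
  exact: measurable_kernel_abs.
- move=> z; rewrite sqr_ge0/= !expr2.
  by apply: ler_pM => //; exact: (le_normc_kernel_op mg gK).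
Qed.

Lemma kernel_op_F2 f : L2 f -> F2 (kernel_op g f).
Proof.
move=> Lf; split; first exact: (entire_kernel_op mg gK).
by apply: (le_lt_trans (kernel_op_bound Lf)); rewrite ltry.
Qed.

Lemma gauss_norm_kernel_op f : L2 f ->
  gauss_norm (kernel_op g f) <= Num.sqrt (4 * K) * gauss_norm f.
Proof.
move=> Lf; have := kernel_op_bound Lf; rewrite sqr_integralE; last exact: (kernel_op_F2 Lf).2.
rewrite lee_fin; apply: ler_sqrtrM; rewrite ?gauss_norm_ge0//.
exact: mulr_ge0.
Qed.

Lemma kernel_op_linear (a : C) f h : L2 f -> L2 h ->
  kernel_op g (fun z => a * f z + h z) = (fun z => a * kernel_op g f z + kernel_op g h z).
Proof.
move=> Lf Lh; apply/funext => z; rewrite /kernel_op.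
have fi := cintegrable_kernel_op mg gK z Lf; have hi := cintegrable_kernel_op mg gK z Lh.
rewrite -cintZ// -cintD//; last exact: cintegrableZ.
by apply: eq_cint => w; ring.
Qed.

(** Fubini, the double integral being absolutely convergent by Schur's test,
    followed by the reproducing property. *)
Lemma kernel_op_adjoint f h : L2 f -> F2 h ->
  gauss_inner (kernel_op g f) h = cint gauss (fun w => g w * f w * (h w)^*).
Proof.
move=> Lf Fh; have Lh := F2_L2 Fh; have [mf _] := Lf; have [mh _] := Lh.
pose F (p : C * C) : C := g p.2 * f p.2 * expC (p.1 * p.2^*) * (h p.1)^*.
have mF : measurable_fun setT F.
  apply: measurable_fun_cM; last first.
    by apply: measurable_fun_conj; exact: (measurableT_comp mh measurable_fst).
  apply: measurable_fun_cM.
    by apply: measurable_fun_cM; [exact: (measurableT_comp mg measurable_snd)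
      |exact: (measurableT_comp mf measurable_snd)].
  apply: measurable_fun_expC; apply: measurable_fun_cM; first exact: measurable_fst.
  by apply: measurable_fun_conj; exact: measurable_snd.
have F2i z : cintegrable gauss (fun w => F (z, w)).
  have := cintegrableZ ((h z)^*) (cintegrable_kernel_op mg gK z Lf).
  by congr cintegrable; apply/funext => w; rewrite mulrC.
have F1i w : cintegrable gauss (fun z => F (z, w)).
  have := cintegrableZ (g w * f w) (cintegrable_L2M (L2_conj (L2_kernelr w)) (L2_conj Lh)).
  by congr cintegrable; apply/funext => z; rewrite conj_kernel /F mulrA.
have Fi : (\int[@gauss_prob R]_z \int[@gauss_prob R]_w (normc (F (z, w)))%:E < +oo)%E.
  have mA : measurable_fun setT (fun z => fine (kernel_abs g f z)).
    by apply: measurableT_comp => //; exact: measurable_kernel_abs.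
  have A0 z : 0 <= fine (kernel_abs g f z) by rewrite fine_ge0// kernel_abs_ge0.
  have h2 : (\int[gauss]_z (normc (h z) ^+ 2)%:E <= (gauss_norm h ^+ 2)%:E)%E.
    by rewrite -sqr_integralE//; exact: Fh.2.
  have C0 : 0 <= 4 * K * gauss_norm f ^+ 2 by rewrite !mulr_ge0// gauss_norm_ge0.
  have HH := ge0_cauchy_schwarz mA (measurable_fun_normc mh) A0 (fun z => normc_ge0 (h z))
    C0 (sqr_ge0 (gauss_norm h)) (schur_test mg K0 gK Lf) h2.
  apply: le_lt_trans (ltry _); apply: le_trans HH.
  rewrite le_eqVlt; apply/orP; left; apply/eqP; apply: eq_integral => z _.
  rewrite mulrC EFinM fineK; last exact: (kernel_abs_fin mg gK).
  rewrite -ge0_integralZl//.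
  - apply: eq_integral => w _; rewrite /F /= normcM normc_conj normcM_expC normcM.
    by rewrite mulrC EFinM.
  - apply/measurable_EFinP; apply: measurable_funM; last first.
      by apply: measurableT_comp => //; exact: measurable_Re_mulr_conj.
    by apply: measurable_funM; exact: measurable_fun_normc.
  - by move=> w _; rewrite lee_fin !mulr_ge0// expR_ge0.
rewrite gauss_inner_cint.
transitivity (cint (@gauss_prob R) (fun z => cint (@gauss_prob R) (fun w => F (z, w)))).
  apply: eq_cint => z; rewrite mulrC /kernel_op -cintZ; last exact: (cintegrable_kernel_op mg gK).
  by apply: eq_cint => w; rewrite mulrC.
rewrite (cint_fubini (m1 := @gauss_prob R) (m2 := @gauss_prob R) mF Fi F2i F1i).
apply: eq_cint => w.
have hk := cintegrable_L2M Lh (L2_kernelr w).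
transitivity (g w * f w * cint gauss (fun z => (h z * expC (w * z^*))^*)); last first.
  congr (_ * _); rewrite -[in RHS](reproducing w Fh).
  exact: (esym (cint_conj hk)).
rewrite -cintZ; last first.
  have := cintegrable_L2M (L2_conj Lh) (L2_conj (L2_kernelr w)).
  by congr cintegrable; apply/funext => z; rewrite conjcM.
apply: eq_cint => z; rewrite conjcM.
transitivity (g w * f w * ((h z)^* * expC (z * w^*))); first by rewrite /F; ring.
by congr (_ * (_ * _)); exact: (esym (conj_kernel z w)).
Qed.

End kernel_operator.

Section projection.
Variable R : realType.
Local Notation C := R[i].
Implicit Types f h u : C -> C.

Lemma berezin_bounded1 : berezin_bounded (fun _ : C => 1 : C) (1 : R).
Proof.
move=> a; rewrite mul1r -integral_sqr_kernel le_eqVlt; apply/orP; left; apply/eqP.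
apply: eq_integral => w _; rewrite normc_one expr1n mul1r.
by rewrite Re_mul_conjC.
Qed.

Lemma F2_kernel (z : C) : F2 (fun w : C => expC (w * z^*)).
Proof.
split.
  apply: (entire_comp (@entire_expC R) (entireM (@entire_id R) (@entire_cst R (z^*)))).
have [_] := L2_kernelr z; congr (_ < _)%E; apply: eq_integral => w _.
by rewrite !normc_expC Re_mul_conjC.
Qed.

Let m1 : measurable_fun setT (fun _ : C => 1 : C). Proof. exact: measurable_cst. Qed.

(** The orthogonal projection is the kernel operator with symbol 1: the adjoint
    formula gives the orthogonality, and testing orthogonality against the
    kernels gives uniqueness. *)
Lemma bargmann_projE f : L2 f -> bargmann_proj f = kernel_op (fun=> 1) f.
Proof.
move=> Lf; rewrite /bargmann_proj.
set P := kernel_op _ f; set Q := [set u | _].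
have FP : F2 P by exact: (kernel_op_F2 m1 ler01 berezin_bounded1 Lf).
have : Q (get Q).
  apply: getPex; exists P; split => // h Fh; rewrite gauss_inner_cint.
  have Lh := F2_L2 Fh.
  transitivity (cint gauss (fun z => f z * (h z)^* + (-1) * (P z * (h z)^*))).
    by apply: eq_cint => z /=; ring.
  have fi := cintegrable_inner Lf Lh; have pi := cintegrable_inner (F2_L2 FP) Lh.
  rewrite cintD//; last exact: cintegrableZ.
  rewrite cintZ// -gauss_inner_cint -[X in _ + _ * X]gauss_inner_cint.
  rewrite (kernel_op_adjoint m1 ler01 berezin_bounded1 Lf Fh) mulN1r.
  have -> : cint gauss (fun w => 1 * f w * (h w)^*) = gauss_inner f h.
    by apply: eq_cint => w; rewrite mul1r.
  by rewrite subrr.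
move: (get Q) => u [Fu uP]; apply/funext => z.
have := uP _ (F2_kernel z); rewrite gauss_inner_cint.
have fi := cintegrable_L2M Lf (L2_kernelr z).
have ui := cintegrable_L2M (F2_L2 Fu) (L2_kernelr z).
have -> : cint gauss (fun w => (f \- u) w * (expC (w * z^*))^*) =
    cint gauss (fun w => f w * expC (z * w^*) + (-1) * (u w * expC (z * w^*))).
  apply: eq_cint => w; transitivity ((f w - u w) * expC (z * w^*)); last by ring.
  by congr (_ * _); exact: conj_kernel.
rewrite cintD//; last exact: cintegrableZ.
rewrite cintZ// (reproducing z Fu) mulN1r => /eqP; rewrite subr_eq0 => /eqP <-.
by apply: eq_cint => w; rewrite mul1r.
Qed.

End projection.

(** * The equivalences *)

Section equivalences.
Variable R : realType.
Local Notation C := R[i].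
Variable g : C -> C.
Hypothesis mg : measurable_fun setT g.
Implicit Types f h : C -> C.
Local Notation nu := (weighted_gauss mg).

Lemma sqr_integral_weighted h : measurable_fun setT h ->
  sqr_integral nu h = (\int[gauss]_z (normc (g z) ^+ 2 * normc (h z) ^+ 2)%:E)%E.
Proof.
move=> mh; rewrite /sqr_integral integral_density//; last first.
  by apply/measurable_EFinP; exact: measurable_sqr_normc.
by apply: eq_integral => z _; rewrite mulrC EFinM.
Qed.

Lemma mul_bounded_carleson : mul_bounded g -> fock_carleson nu.
Proof.
move=> [K K0 gK]; exists K; first exact: K0.
by move=> h Fh; rewrite sqr_integral_weighted; [exact: gK|exact: measurable_entire Fh.1].
Qed.

Lemma normc_normalized_kernel (a z : C) :
  normc (normalized_kernel a z) ^+ 2 = expR (2 * complex.Re (z * a^*) - normc a ^+ 2).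
Proof.
rewrite /normalized_kernel normc_expC expR_sqr ReD ReN /=; congr expR.
by field.
Qed.

Lemma F2_normalized_kernel (a : C) : F2 (normalized_kernel a).
Proof.
have E : normalized_kernel a = fun z : C => expC (z * a^*) * expC (- (normc a ^+ 2 / 2)%:C).
  by apply/funext => z; rewrite -expCD.
split.
  by rewrite E; exact: (entireM (F2_kernel a).1 (@entire_cst R _)).
rewrite E; have [] // := L2Z (expC (- (normc a ^+ 2 / 2)%:C)) (F2_L2 (F2_kernel a)).
by move=> _; congr (_ < _)%E; apply: eq_integral => z _; rewrite mulrC.
Qed.

Lemma sqr_integral_normalized_kernel (a : C) :
  sqr_integral gauss (normalized_kernel a) = 1%E.
Proof.
rewrite /sqr_integral.
transitivity (\int[gauss]_z ((expR (- normc a ^+ 2))%:E * (expR (2 * complex.Re (a * z^*)))%:E))%E.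
  apply: eq_integral => z _.
  by rewrite normc_normalized_kernel -EFinM -expRD addrC Re_mul_conjC.
rewrite ge0_integralZl//.
- by rewrite integral_sqr_kernel -EFinM -expRD addNr expR0.
- apply/measurable_EFinP; apply: measurableT_comp => //; apply: measurable_funM => //.
  exact: measurable_Re_mulr_conj.
Qed.

Lemma carleson_kernel : fock_carleson nu ->
  (ereal_sup [set sqr_integral nu (normalized_kernel a) | a in [set: C]] < +oo)%E.
Proof.
move=> [K K0 nuK]; apply: (@le_lt_trans _ _ K%:E); last by rewrite ltry.
apply: ge_ereal_sup => _ [a _ <-].
have := nuK _ (F2_normalized_kernel a).
by rewrite sqr_integral_normalized_kernel mule1.
Qed.

Lemma kernel_berezin :
  (ereal_sup [set sqr_integral nu (normalized_kernel a) | a in [set: C]] < +oo)%E ->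
  exists2 K : R, 0 <= K & berezin_bounded g K.
Proof.
set s := ereal_sup _ => soo.
have le_s a : (sqr_integral nu (normalized_kernel a) <= s)%E.
  by apply: ereal_sup_ubound; exists a.
have s0 : (0 <= s)%E by apply: le_trans (le_s 0); exact: sqr_integral_ge0.
have sE : s = (fine s)%:E by rewrite fineK// ge0_fin_numE.
exists (fine s); first by rewrite fine_ge0.
move=> a; have := le_s a.
rewrite sqr_integral_weighted; last exact: (measurable_entire (F2_normalized_kernel a).1).
rewrite sE => h.
have -> : (\int[gauss]_w (normc (g w) ^+ 2 * expR (2 * complex.Re (w * a^*)))%:E =
  (expR (normc a ^+ 2))%:E *
  \int[gauss]_w (normc (g w) ^+ 2 * normc (normalized_kernel a w) ^+ 2)%:E)%E.
  rewrite -ge0_integralZl//.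
  - apply: eq_integral => w _; rewrite normc_normalized_kernel -EFinM mulrCA -expRD.
    by congr (_ * expR _)%:E; ring.
  - apply/measurable_EFinP; apply: measurable_funM; apply: measurable_sqr_normc => //.
    exact: (measurable_entire (F2_normalized_kernel a).1).
  - by move=> w _; rewrite lee_fin mulr_ge0 ?sqr_ge0.
rewrite mulrC EFinM; apply: lee_wpmul2l => //.
Qed.

(** The Berezin transform is the heat transform: the exponents agree. *)
Lemma kernel_heat (a : C) :
  (sqr_integral nu (normalized_kernel a) =
  (pi^-1)%:E * \int[planar_lebesgue]_z (expR (- normc (z - a) ^+ 2) * normc (g z) ^+ 2)%:E)%E.
Proof.
have mk := measurable_entire (F2_normalized_kernel a).1.
rewrite sqr_integral_weighted// integral_density//; last first.
  by apply/measurable_EFinP; apply: measurable_funM; exact: measurable_sqr_normc.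
rewrite -ge0_integralZl//.
- apply: eq_integral => z _; rewrite normc_normalized_kernel /gauss_weight -!EFinM.
  have -> : expR (- normc (z - a) ^+ 2) =
      expR (2 * complex.Re (z * a^*) - normc a ^+ 2) * expR (- normc z ^+ 2).
    rewrite -expRD; congr expR.
    by rewrite !sqr_normcE ReM ReD ImD ReN ImN Re_conj Im_conj; ring.
  by congr EFin; ring.
- apply/measurable_EFinP; apply: measurable_funM; last exact: measurable_sqr_normc.
  apply: measurableT_comp => //; apply: measurable_funN; apply: measurable_sqr_normc.
  by apply: measurable_fun_cB => //; exact: measurable_cst.
- by move=> z _; rewrite lee_fin mulr_ge0 ?sqr_ge0 ?expR_ge0.
- by rewrite lee_fin invr_ge0 pi_ge0.
Qed.

Lemma L2_mul_bounded f : mul_bounded g -> F2 f -> L2 (g \* f).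
Proof.
move=> [K K0 gK] Ff; have [mf fi] := F2_L2 Ff; split; first exact: measurable_fun_cM.
apply: (@le_lt_trans _ _ (K%:E * sqr_integral gauss f)%E).
  have := gK f Ff; congr (_ <= _)%E; apply: eq_integral => z _.
  by rewrite normcM exprMn.
by rewrite lte_mul_pinfty// lee_fin ltW.
Qed.

Lemma gauss_norm_mul_bounded : mul_bounded g -> exists2 K : R, 0 <= K &
  forall f, F2 f -> gauss_norm (g \* f) <= K * gauss_norm f.
Proof.
move=> gb; have [K K0 gK] := gb; exists (Num.sqrt K) => // f Ff.
have := gK f Ff; rewrite (sqr_integralE Ff.2) => h.
have Lgf := L2_mul_bounded gb Ff.
have : (sqr_integral gauss (g \* f)%R <= (K * gauss_norm f ^+ 2)%:E)%E.
  rewrite EFinM; apply: le_trans h; rewrite le_eqVlt; apply/orP; left; apply/eqP.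
  by apply: eq_integral => z _; rewrite normcM exprMn.
rewrite (sqr_integralE Lgf.2) lee_fin.
by apply: ler_sqrtrM; rewrite ?gauss_norm_ge0// ltW.
Qed.

Lemma toeplitz_integrandE f h z :
  toeplitz_integrand g f h z = (g z * f z) * (g z * h z)^*.
Proof.
rewrite /toeplitz_integrand sqr_normcE conjcM.
have -> : (complex.Re (g z) ^+ 2 + complex.Im (g z) ^+ 2)%:C = g z * (g z)^*.
  by apply: complexP; rewrite !(ReM, ImM) Re_conj Im_conj /=; ring.
by ring.
Qed.

Lemma mul_bounded_toeplitz : mul_bounded g -> toeplitz_form_bounded g.
Proof.
move=> gb; split.
  move=> f h Ff Fh.
  have [mi ii] := cintegrable_inner (L2_mul_bounded gb Ff) (L2_mul_bounded gb Fh).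
  apply/integrableP; split.
    apply/measurable_EFinP; apply: measurable_fun_normc.
    by move: mi; congr (measurable_fun _ _); apply/funext => z; rewrite toeplitz_integrandE.
  move: ii; congr (_ < _)%E; apply: eq_integral => z _.
  by rewrite toeplitz_integrandE /= ger0_norm.
have [K K0 gK] := gauss_norm_mul_bounded gb.
exists (K ^+ 2) => f h Ff Fh.
have -> : toeplitz_form g f h = gauss_inner (g \* f) (g \* h).
  by apply: eq_cint => z; exact: toeplitz_integrandE.
apply: (le_trans (le_normc_gauss_inner (L2_mul_bounded gb Ff) (L2_mul_bounded gb Fh))).
have -> : K ^+ 2 * gauss_norm f * gauss_norm h = (K * gauss_norm f) * (K * gauss_norm h) by ring.
by apply: ler_pM; rewrite ?gauss_norm_ge0//; exact: gK.
Qed.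

Lemma toeplitz_mul_bounded : toeplitz_form_bounded g -> mul_bounded g.
Proof.
move=> [conv [K gK]]; exists (`|K| + 1); first by rewrite ltr_wpDl.
move=> h Fh; rewrite (sqr_integralE Fh.2).
pose I := (\int[gauss]_z (normc (g z) ^+ 2 * normc (h z) ^+ 2)%:E)%E.
have nE z : normc (toeplitz_integrand g h h z) = normc (g z) ^+ 2 * normc (h z) ^+ 2.
  by rewrite toeplitz_integrandE !(normcM, normc_conj); ring.
have Ioo : (I < +oo)%E.
  have /integrableP[_] := conv _ _ Fh Fh; congr (_ < _)%E; apply: eq_integral => z _.
  by rewrite /= ger0_norm// nE.
have I0 : (0 <= I)%E by apply: integral_ge0 => z _; rewrite lee_fin mulr_ge0 ?sqr_ge0.
have IE : I = (fine I)%:E by rewrite fineK// ge0_fin_numE.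
have formE : complex.Re (toeplitz_form g h h) = fine I.
  rewrite /toeplitz_form /=; congr fine; apply: eq_integral => z _.
  rewrite toeplitz_integrandE ReM Re_conj Im_conj mulrN opprK -!expr2 -sqr_normcE.
  by rewrite normcM exprMn.
rewrite -/I IE -EFinM lee_fin -formE.
apply: (le_trans (ler_norm _)); apply: (le_trans (ler_Re_normc _)).
apply: (le_trans (gK _ _ Fh Fh)); rewrite -mulrA -expr2 ler_wpM2r ?sqr_ge0//.
by rewrite (le_trans (ler_norm _))// lerDl.
Qed.

Lemma berezin_U_extends (K : R) : 0 <= K -> berezin_bounded g K ->
  U_extends_boundedly g.
Proof.
move=> K0 gK; exists (kernel_op g); split.
  split.
  - by move=> f Lf; exact: (kernel_op_F2 mg K0 gK Lf).
  - by move=> a f h Lf Lh; exact: (kernel_op_linear mg gK a Lf Lh).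
  - exists (Num.sqrt (4 * K)) => f Lf; exact: (gauss_norm_kernel_op mg K0 gK Lf).
move=> f [Lf Lgf]; rewrite /U_op bargmann_projE//.
by apply/funext => z; apply: eq_cint => w /=; rewrite mul1r.
Qed.

End equivalences.

Section extension.
Variable R : realType.
Local Notation C := R[i].
Variable g : C -> C.
Hypothesis mg : measurable_fun setT g.
Implicit Types f h : C -> C.

(** Testing an extension on the truncations of [h] times the conjugate of [g]
    to the sets where [|g| <= n]. *)
Lemma U_extends_mul_bounded : U_extends_boundedly g -> mul_bounded g.
Proof.
move=> [T [[TF2 _ [K TK]] TU]].
exists (K ^+ 2 + 1); first by rewrite ltr_wpDl// sqr_ge0.
move=> h Fh; have Lh := F2_L2 Fh; have [mh hi] := Lh.
pose E n : set C := [set z | normc (g z) <= n%:R].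
have mE n : measurable (E n).
  rewrite -[X in measurable X]setTI.
  have := measurable_fun_ler (measurable_fun_normc mg) (measurable_cst (n%:R : R))
    measurableT (Y := [set true]).
  by move=> /(_ I); congr measurable; apply/seteqP; split => z //= [].
pose u n z : R := (\1_(E n) z : R).
have mu n : measurable_fun setT (u n) by exact: measurable_indic.
have u01 n z : u n z = 0 \/ (u n z = 1 /\ normc (g z) <= n%:R).
  rewrite /u indicE; case: (boolP (z \in E n)); last by left.
  by rewrite inE; right.
pose f n z : C := (u n z)%:C * ((g z)^* * h z).
have mf n : measurable_fun setT (f n).
  apply: measurable_fun_cM; first exact: measurable_fun_real.
  by apply: measurable_fun_cM => //; exact: measurable_fun_conj.
have L2bnd (k : C -> C) (c : R) : measurable_fun setT k -> 0 <= c ->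
    (forall z, normc (k z) <= c * normc (h z)) -> L2 k.
  move=> mk c0 kc; have [_ chi] := L2Z (c%:C) Lh; split => //.
  apply: le_lt_trans chi; apply: ge0_le_integralT.
  - exact: measurable_sqr_normc.
  - by apply: measurable_sqr_normc; apply: measurable_fun_cM => //; exact: measurable_cst.
  - move=> z; rewrite sqr_ge0/= normcM normc_real ger0_norm//.
    by rewrite ler_pXn2r// nnegrE// mulr_ge0.
have Lf n : L2 (f n).
  apply: (@L2bnd _ n%:R) => // z; rewrite /f !normcM normc_real normc_conj.
  case: (u01 n z) => [->|[-> gz]]; first by rewrite normr0 mul0r mulr_ge0.
  by rewrite normr1 mul1r ler_wpM2r.
have Lgf n : L2 (g \* f n).
  apply: (@L2bnd _ (n%:R ^+ 2)); first exact: measurable_fun_cM.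
    by rewrite exprn_ge0.
  move=> z /=; rewrite /f !normcM normc_real normc_conj.
  case: (u01 n z) => [->|[-> gz]]; first by rewrite normr0 mul0r mulr0 mulr_ge0// exprn_ge0.
  by rewrite normr1 mul1r mulrA -expr2 ler_wpM2r// ler_pXn2r// nnegrE.
have fE n z : normc (f n z) ^+ 2 = u n z * (normc (g z) ^+ 2 * normc (h z) ^+ 2).
  rewrite /f !normcM normc_real normc_conj.
  by case: (u01 n z) => [->|[-> _]]; rewrite ?normr0 ?normr1; ring.
have key n : gauss_norm (f n) <= `|K| * gauss_norm h.
  have TE : T (f n) = kernel_op (fun=> 1) (g \* f n).
    by rewrite TU// /U_op bargmann_projE.
  have inner : gauss_inner (T (f n)) h = gauss_inner (f n) (f n).
    rewrite TE (kernel_op_adjoint (@measurable_cst _ _ _ _ _ _) ler01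
      (@berezin_bounded1 R) (Lgf n) Fh).
    apply: eq_cint => z; rewrite /f /=.
    case: (u01 n z) => [->|[-> _]].
      by rewrite mul0r mulr0 !mul0r mulr0 mul0r.
    by rewrite !mul1r !conjcM conjCK; ring.
  have := le_normc_gauss_inner (F2_L2 (TF2 _ (Lf n))) Lh.
  rewrite inner gauss_inner_self// normc_real ger0_norm ?sqr_ge0// => h1.
  have h2 : gauss_norm (T (f n)) <= `|K| * gauss_norm (f n).
    by apply: (le_trans (TK _ (Lf n))); rewrite ler_wpM2r ?gauss_norm_ge0 ?ler_norm.
  have h3 : gauss_norm (f n) ^+ 2 <= `|K| * gauss_norm h * gauss_norm (f n).
    by rewrite mulrAC; apply: (le_trans h1); rewrite ler_wpM2r ?gauss_norm_ge0.
  have [->|fn0] := eqVneq (gauss_norm (f n)) 0; first by rewrite mulr_ge0 ?gauss_norm_ge0.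
  have fn1 : 0 < gauss_norm (f n) by rewrite lt_neqAle eq_sym fn0 gauss_norm_ge0.
  by rewrite -(ler_pM2r fn1) -expr2.
have sq n : (\int[gauss]_z (u n z * (normc (g z) ^+ 2 * normc (h z) ^+ 2))%:E <=
    (K ^+ 2 * gauss_norm h ^+ 2)%:E)%E.
  under eq_integral do rewrite -fE.
  rewrite -/(sqr_integral gauss (f n)) (sqr_integralE (Lf n).2) lee_fin.
  have -> : K ^+ 2 * gauss_norm h ^+ 2 = (`|K| * gauss_norm h) ^+ 2.
    by rewrite exprMn real_normK// num_real.
  by rewrite ler_pXn2r// nnegrE ?gauss_norm_ge0// mulr_ge0 ?gauss_norm_ge0.
pose v n z : \bar R := (u n z * (normc (g z) ^+ 2 * normc (h z) ^+ 2))%:E.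
have p0 z : 0 <= normc (g z) ^+ 2 * normc (h z) ^+ 2 by rewrite mulr_ge0 ?sqr_ge0.
have u0 n z : 0 <= u n z by case: (u01 n z) => [->|[-> _]].
have mv n : measurable_fun setT (v n).
  apply/measurable_EFinP; apply: measurable_funM => //.
  by apply: measurable_funM; exact: measurable_sqr_normc.
have v0 n z : [set: C] z -> (0 <= v n z)%E by rewrite lee_fin mulr_ge0.
have v_nd z : [set: C] z -> {homo v ^~ z : n m / (n <= m)%N >-> (n <= m)%E}.
  move=> _ n m nm; rewrite lee_fin ler_wpM2r// /u !indicE ler_nat.
  case: (boolP (z \in E n)) => // /set_mem zn; rewrite mem_set//.
  by rewrite /E /= (le_trans zn)// ler_nat.
have lim_v z : (normc (g z) ^+ 2 * normc (h z) ^+ 2)%:E = limn (v ^~ z).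
  apply/esym/cvg_lim => //; apply: cvg_near_cst.
  exists (Num.bound (normc (g z))) => // n /= nz; rewrite /v /u indicE mem_set ?mul1r//.
  by rewrite /E /= ltW// (lt_le_trans (archi_boundP (normc_ge0 _)))// ler_nat.
under eq_integral do rewrite lim_v.
rewrite (monotone_convergence gauss measurableT mv v0 v_nd).
apply: (@le_trans _ _ (K ^+ 2 * gauss_norm h ^+ 2)%:E).
  apply: lime_le; last by apply: nearW => n; exact: sq.
  apply: ereal_nondecreasing_is_cvgn => n m nm; apply: ge0_le_integral => //.
  - by move=> z zT; exact: v0.
  - by move=> z zT; exact: v_nd.
rewrite (sqr_integralE hi) -EFinM lee_fin ler_wpM2r ?sqr_ge0//.
by rewrite lerDl.
Qed.

(** The Toeplitz operator: multiply by [g], then apply the kernel operator whose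
    symbol is the conjugate of [g]. *)
Lemma toeplitz_operator : mul_bounded g ->
  (exists2 K : R, 0 <= K & berezin_bounded g K) ->
  induces_bounded_toeplitz_operator g.
Proof.
move=> gb [K K0 gK]; have [conv _] := mul_bounded_toeplitz mg gb; split => //.
pose gc z := (g z)^*.
have mgc : measurable_fun setT gc by exact: measurable_fun_conj.
have gcK : berezin_bounded gc K.
  by move=> a; under eq_integral do rewrite /gc normc_conj; exact: gK.
have Lg f := L2_mul_bounded mg gb (f := f).
exists (fun f => kernel_op gc (g \* f)); split; last first.
  move=> f h Ff Fh; rewrite (kernel_op_adjoint mgc K0 gcK (Lg _ Ff) Fh).
  apply: eq_cint => z; rewrite toeplitz_integrandE /gc /= conjcM; ring.
split.
- by move=> f Ff; exact: (kernel_op_F2 mgc K0 gcK (Lg _ Ff)).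
- move=> a f h Ff Fh; rewrite -(kernel_op_linear mgc gcK a (Lg _ Ff) (Lg _ Fh)).
  by congr (kernel_op gc _); apply/funext => z /=; ring.
- have [M M0 gM] := gauss_norm_mul_bounded mg gb.
  exists (Num.sqrt (4 * K) * M) => f Ff.
  apply: (le_trans (gauss_norm_kernel_op mgc K0 gcK (Lg _ Ff))).
  by rewrite -mulrA ler_wpM2l//; exact: gM.
Qed.

Lemma toeplitz_operator_form : induces_bounded_toeplitz_operator g ->
  toeplitz_form_bounded g.
Proof.
move=> [conv [T [[TF2 _ [K TK]] TE]]]; split => //; exists K => f h Ff Fh.
rewrite -TE//; apply: (le_trans (le_normc_gauss_inner (F2_L2 (TF2 _ Ff)) (F2_L2 Fh))).
by rewrite ler_wpM2r ?gauss_norm_ge0//; exact: TK.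
Qed.

End extension.

Local Open Scope complex_scope.

Theorem theorem1p3 (R : realType) (g : R[i] -> R[i])
    (mg : measurable_fun setT g) :
  let nu := weighted_gauss mg in
  let kernel_sup := ereal_sup
    [set sqr_integral nu (normalized_kernel a) | a in [set: R[i]]] in
  let heat_sup := ereal_sup
    [set (pi^-1)%:E * \int[planar_lebesgue]_z
           (expR (- normc (z - a) ^+ 2) * normc (g z) ^+ 2)%:E
    | a in [set: R[i]]]%E in
  [/\ [<-> U_extends_boundedly g;
           mul_bounded g;
           fock_carleson nu;
           (kernel_sup < +oo)%E;
           toeplitz_form_bounded g],
      kernel_sup = heat_sup
    & toeplitz_form_bounded g <-> induces_bounded_toeplitz_operator g].
Proof.
move=> nu kernel_sup heat_sup.
have h23 : mul_bounded g -> (kernel_sup < +oo)%E.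
  by move=> gb; exact: (carleson_kernel (mul_bounded_carleson mg gb)).
have h30 : (kernel_sup < +oo)%E -> U_extends_boundedly g.
  by move=> /kernel_berezin[K K0 gK]; exact: (berezin_U_extends mg K0 gK).
have h01 := U_extends_mul_bounded mg.
split.
- tfae.
  + exact: h01.
  + exact: mul_bounded_carleson.
  + exact: carleson_kernel.
  + by move=> /h30 /h01; exact: mul_bounded_toeplitz.
  + by move=> /toeplitz_mul_bounded /h23.
- congr ereal_sup; apply/seteqP; split => _ [a _ <-]; exists a => //.
    by rewrite kernel_heat.
  by rewrite kernel_heat.
- split; last exact: toeplitz_operator_form.
  move=> /toeplitz_mul_bounded gb.
  by apply: toeplitz_operator => //; apply: (kernel_berezin (mg := mg)); exact: h23.
Qed.
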